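(* Let $n\ge 1$ and let $U$ be an $n$-tame subset of $S^{n-1}$ which is either (i) closed, or (ii) open with finitely many connected components. Then: (B1) $U$ is contained in a weakly maxtame subset of $S^{n-1}$; and (B2) if $n\le 3$, $U$ is contained in a maxtame subset of $S^{n-1}$.
   Context: $S^{n-1}$ is the unit sphere in $\mathbb R^n$. For a natural number $m$, an ''$m$-point subset'' means a non-empty subset with at most $m$ points. A finite subset of $\mathbb R^n$ is balanced if its convex hull contains the origin. A subset $V\subseteq S^{n-1}$ is $m$-tame if every $m$-point subset of $V$ is contained in some open hemisphere of $S^{n-1}$, equivalently if $V$ has no balanced $m$-point subsets. A subset $U$ of $S^{n-1}$ is weakly maxtame if $U$ is open and $n$-tame, the set $\pi_0(U)$ of its components is finite, and $U$ is maximal (under inclusion) amongst open $n$-tame subsets of $S^{n-1}$ with at most $|\pi_0(U)|$ components. A weakly maxtame set is maxtame if it is maximal amongst all open $n$-tame subsets of $S^{n-1}$. *)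

(* Defs.v *)
From HB Require Import structures.
From mathcomp Require Import all_boot all_order all_algebra.
From mathcomp Require Import all_classical all_reals all_analysis.

Set Implicit Arguments.
Unset Strict Implicit.
Unset Printing Implicit Defensive.

Import Order.TTheory GRing.Theory Num.Theory.
Import numFieldNormedType.Exports.

Local Open Scope classical_set_scope.
Local Open Scope card_scope.
Local Open Scope ring_scope.

(* R^n is 'rV[R]_n. Its library topology is entrywise (product) convergence,
   which is the Euclidean topology; the library norm on 'rV[R]_n is the sup norm,
   hence the explicit Euclidean inner product below. *)
Definition dot (R : realType) (n : nat) (x y : 'rV[R]_n) : R :=
  \sum_(i < n) x ord0 i * y ord0 i.

Definition sphere (R : realType) (n : nat) : set 'rV[R]_n :=
  [set x | dot x x = 1].

Definition open_hemisphere (R : realType) (n : nat) (v : 'rV[R]_n) :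
    set 'rV[R]_n :=
  [set x | sphere x /\ 0 < dot x v].

(* Openness and closedness in the subspace topology of S. *)
Definition open_in (T : topologicalType) (S U : set T) : Prop :=
  exists2 O : set T, open O & U = O `&` S.

Definition closed_in (T : topologicalType) (S U : set T) : Prop :=
  exists2 C : set T, closed C & U = C `&` S.

(* pi_0(U); connectedness of a subset does not depend on the ambient space. *)
Definition components (T : topologicalType) (U : set T) : set (set T) :=
  connected_component U @` U.

(* "m-point" means non-empty with at most m points. *)
Definition point_subset (T : Type) (m : nat) (V F : set T) : Prop :=
  [/\ F `<=` V, F !=set0 & F #<= `I_m].

Definition tame (R : realType) (n m : nat) (V : set 'rV[R]_n) : Prop :=
  V `<=` @sphere R n /\
  forall F : set 'rV[R]_n, point_subset m V F ->
    exists2 v : 'rV[R]_n, sphere v & F `<=` open_hemisphere v.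

(* Here the number n of points is the dimension of the ambient space. *)
Definition weakly_maxtame (R : realType) (n : nat) (U : set 'rV[R]_n) : Prop :=
  [/\ open_in (@sphere R n) U,
      tame n U,
      finite_set (components U) &
      forall V : set 'rV[R]_n, open_in (@sphere R n) V -> tame n V ->
        components V #<= components U -> U `<=` V -> V = U].

Definition maxtame (R : realType) (n : nat) (U : set 'rV[R]_n) : Prop :=
  weakly_maxtame U /\
  forall V : set 'rV[R]_n, open_in (@sphere R n) V -> tame n V ->
    U `<=` V -> V = U.

(* Main.v *)
Require Import Defs.
From mathcomp Require Import all_boot all_order all_algebra.
From mathcomp Require Import all_classical all_reals all_analysis.
From mathcomp Require Import ring lra.

Set Implicit Arguments.
Unset Strict Implicit.
Unset Printing Implicit Defensive.

Import Order.TTheory GRing.Theory Num.Theory.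
Import numFieldNormedType.Exports.

Local Open Scope classical_set_scope.
Local Open Scope card_scope.
Local Open Scope ring_scope.

(** Call a set balanced if 0 is a positive combination of its points.

    Weakly maxtame sets come from Zorn's lemma applied to the open n-tame sets
    with at most as many components as [U]; a closed [U] is first thickened by
    compactness to an open set with finitely many components.

    Maxtame sets, n <= 3.  In an n-tame set no n+1 balanced points have two of
    them in one component: moving one point along the component would produce a
    balanced set of n points (Fenchel-Bunt).  Hence any n components lie in a
    common open hemisphere, and intersecting these hemispheres gives an n-tame
    finite union of polyhedral cones above [U].  For such a union [W] let O(W) be
    the complement of minus the closure of the set of sums of at most n-1 points
    of [W].  Every open n-tame set above [W] lies in O(W), so W = O(W) suffices;
    O(W) is again a finite union of polyhedral cones, by Fourier-Motzkin
    elimination.  Since n <= 3, if [X] is a convex cone with [- X] disjoint from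
    [W], then adjoining [X `&` O(W)] keeps [W] n-tame.  Doing this for the
    finitely many cones of O(W) `&` - O(W) `&` {g > 0} makes O(W) disjoint from
    - O(W), and then doing it for those of O(W) makes W = O(W). *)

(** * Inner product and normalization *)

Section Dot.
Variables (R : realType) (n : nat).
Implicit Types (x y v : 'rV[R]_n).

Lemma dotC x y : dot x y = dot y x.
Proof. by apply: eq_bigr => i _; rewrite mulrC. Qed.

Lemma dotDl x y v : dot (x + y) v = dot x v + dot y v.
Proof. by rewrite /dot -big_split/=; apply: eq_bigr => i _; rewrite mxE mulrDl. Qed.

Lemma dotZl (a : R) x v : dot (a *: x) v = a * dot x v.
Proof. by rewrite /dot mulr_sumr; apply: eq_bigr => i _; rewrite mxE mulrA. Qed.

Lemma dot0l v : dot 0 v = 0.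
Proof. by rewrite /dot big1// => i _; rewrite mxE mul0r. Qed.

Lemma dotNl x v : dot (- x) v = - dot x v.
Proof. by rewrite -scaleN1r dotZl mulN1r. Qed.

Lemma dotDr v x y : dot v (x + y) = dot v x + dot v y.
Proof. by rewrite !(dotC v) dotDl. Qed.

Lemma dotZr (a : R) v x : dot v (a *: x) = a * dot v x.
Proof. by rewrite !(dotC v) dotZl. Qed.

Lemma dot0r v : dot v 0 = 0.
Proof. by rewrite dotC dot0l. Qed.

Lemma dotNr v x : dot v (- x) = - dot v x.
Proof. by rewrite !(dotC v) dotNl. Qed.

Lemma dot_ge0 x : 0 <= dot x x.
Proof. by apply: sumr_ge0 => i _; rewrite -expr2 sqr_ge0. Qed.

Lemma dot_eq0 x : (dot x x == 0) = (x == 0).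
Proof.
apply/eqP/eqP => [x0|->]; last exact: dot0l.
apply/rowP => i; rewrite mxE; apply/eqP.
have /(_ i isT) : forall j, true -> x ord0 j * x ord0 j = 0.
  by apply/psumr_eq0P => // j _; rewrite -expr2 sqr_ge0.
by move/eqP; rewrite mulf_eq0 orbb.
Qed.

Lemma dot_gt0 x : (0 < dot x x) = (x != 0).
Proof. by rewrite lt_neqAle dot_ge0 andbT eq_sym dot_eq0. Qed.

Lemma sphere_neq0 x : sphere x -> x != 0.
Proof. by rewrite /sphere/= -dot_gt0 => ->. Qed.

Lemma dot_delta v i : dot v (delta_mx ord0 i) = v ord0 i.
Proof.
rewrite /dot (bigD1 i)//= mxE !eqxx mulr1 big1 ?addr0// => j ji.
by rewrite mxE eqxx/= (negbTE ji) mulr0.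
Qed.

(** The zero vector is sent to itself, hence stays off the sphere. *)
Definition normalize x : 'rV[R]_n := (Num.sqrt (dot x x))^-1 *: x.

Lemma sqrt_dot_gt0 x : x != 0 -> 0 < (Num.sqrt (dot x x))^-1.
Proof. by move=> x0; rewrite invr_gt0 sqrtr_gt0 dot_gt0. Qed.

Lemma normalize_sphere x : x != 0 -> sphere (normalize x).
Proof.
move=> x0; rewrite /sphere/= /normalize dotZl dotZr mulrA -invfM -expr2.
by rewrite sqr_sqrtr ?dot_ge0// mulVf// dot_eq0.
Qed.

Lemma normalize_id x : sphere x -> normalize x = x.
Proof. by rewrite /sphere/normalize/= => ->; rewrite sqrtr1 invr1 scale1r. Qed.

End Dot.

Lemma dot_row_mx (R : realType) (m n : nat) (a : 'rV[R]_(m + n)) x y :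
  dot a (row_mx x y) = dot (lsubmx a) x + dot (rsubmx a) y.
Proof.
rewrite /dot big_split_ord/=; congr (_ + _); apply: eq_bigr => i _.
  by rewrite row_mxEl !mxE.
by rewrite row_mxEr !mxE.
Qed.

(** * Positive combinations, polyhedral cones and Fourier-Motzkin elimination *)

Section Cones.
Variables (R : realType) (n : nat).
Local Notation V := 'rV[R]_n.

(** Scalars are strictly positive, so that a conic set may avoid the origin. *)
Definition conic (K : set V) :=
  (forall x y, K x -> K y -> K (x + y)) /\
  (forall (a : R) x, 0 < a -> K x -> K (a *: x)).

Definition lincomb (s : seq (R * V)) : V := \sum_(p <- s) p.1 *: p.2.

Definition pos_in (A : set V) (s : seq (R * V)) :=
  forall p, p \in s -> 0 < p.1 /\ A p.2.

(** A non-empty list with positive coefficients excludes the trivial combination, so [conek k A 0]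
    means that [A] has a balanced set of at most [k] points; repetitions are harmless. *)
Definition conek (k : nat) (A : set V) (x : V) :=
  exists s : seq (R * V), [/\ s != [::], (size s <= k)%N, pos_in A s & x = lincomb s].

Definition coneh (A : set V) (x : V) := exists k, conek k A x.

Lemma pos_in_cons A p s : pos_in A (p :: s) <-> (0 < p.1 /\ A p.2) /\ pos_in A s.
Proof.
split=> [H|[H1 H2] q]; last by rewrite inE => /orP[/eqP->//|/H2].
by split=> [|q qs]; apply: H; rewrite inE ?eqxx ?qs ?orbT.
Qed.

Lemma pos_in_sub A B s : (forall p, p \in s -> A p.2 -> B p.2) -> pos_in A s -> pos_in B s.
Proof. by move=> AB As p ps; have [? ?] := As _ ps; split=> //; exact: AB. Qed.

Lemma conekS k l A B : (k <= l)%N -> A `<=` B -> conek k A `<=` conek l B.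
Proof.
move=> kl AB x [s [s0 sk sA ->]]; exists s; split=> //; first exact: leq_trans kl.
by apply: pos_in_sub sA => p _; apply: AB.
Qed.

Lemma lincomb0 : lincomb [::] = 0.
Proof. by rewrite /lincomb big_nil. Qed.

Lemma lincomb1 p : lincomb [:: p] = p.1 *: p.2.
Proof. by rewrite /lincomb big_seq1. Qed.

Lemma lincomb_cat s t : lincomb (s ++ t) = lincomb s + lincomb t.
Proof. by rewrite /lincomb big_cat. Qed.

Lemma lincomb_scale a s : lincomb [seq (a * p.1, p.2) | p <- s] = a *: lincomb s.
Proof.
rewrite /lincomb big_map scaler_sumr; apply: eq_bigr => p _ /=.
by rewrite scalerA.
Qed.

Lemma pos_in_scale A (a : R) s :
  0 < a -> pos_in A s -> pos_in A [seq (a * p.1, p.2) | p <- s].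
Proof.
by move=> a0 As q /mapP[p /As[p0 Ap] ->]/=; split=> //; exact: mulr_gt0.
Qed.

Lemma conekZ k A a x : 0 < a -> conek k A x -> conek k A (a *: x).
Proof.
move=> a0 [s [s0 sk sA ->]]; exists [seq (a * p.1, p.2) | p <- s]; split.
- by case: s s0 {sk sA}.
- by rewrite size_map.
- exact: pos_in_scale.
- by rewrite lincomb_scale.
Qed.

Lemma conekD k l A x y : conek k A x -> conek l A y -> conek (k + l) A (x + y).
Proof.
move=> [s [s0 sk sA ->]] [t [t0 tl tA ->]]; exists (s ++ t); split.
- by case: s s0 {sk sA}.
- by rewrite size_cat leq_add.
- by move=> p; rewrite mem_cat => /orP[/sA|/tA].
- by rewrite lincomb_cat.
Qed.

Lemma conek1 k A x : A x -> conek k.+1 A x.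
Proof.
move=> Ax; exists [:: (1, x)]; split=> //; last by rewrite /lincomb big_seq1 scale1r.
by move=> p; rewrite inE => /eqP ->/=.
Qed.

Lemma coneh_conic A : conic (coneh A).
Proof.
split=> [x y [k Ax] [l Ay]|a x a0 [k Ax]]; first by exists (k + l)%N; exact: conekD.
by exists k; exact: conekZ.
Qed.

Lemma sub_coneh A : A `<=` coneh A.
Proof. by move=> x Ax; exists 1%N; exact: conek1. Qed.

Lemma conic_lincomb K s : conic K -> s != [::] -> pos_in K s -> K (lincomb s).
Proof.
move=> [KD KZ]; elim: s => //= p s IH _ /pos_in_cons[[p0 Kp] Ks].
rewrite /lincomb big_cons; case: s IH Ks => [|q s] IH Ks.
  by rewrite big_nil addr0; exact: KZ.
by apply: KD; [exact: KZ|exact: IH].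
Qed.

Lemma dot_lincomb_gt0 A s v : s != [::] -> pos_in A s ->
  (forall x, A x -> 0 < dot x v) -> 0 < dot (lincomb s) v.
Proof.
move=> s0 sA Av; apply: (conic_lincomb (K := [set x | 0 < dot x v])) => //.
  split=> [x y|a x] /=; first by rewrite dotDl; exact: addr_gt0.
  by move=> a0 ?; rewrite dotZl mulr_gt0.
by apply: pos_in_sub sA => p _; exact: Av.
Qed.

(** Strict inequalities make the cone open; the empty list gives the whole space. *)
Definition polycone (c : seq V) : set V := [set x | forall a, a \in c -> 0 < dot a x].

Lemma polycone_conic c : conic (polycone c).
Proof.
split=> [x y cx cy a ac|a x a0 cx b bc].
  by rewrite dotDr addr_gt0// ?cx// cy.
by rewrite dotZr mulr_gt0// cx.
Qed.

Lemma polycone_cons a c x : polycone (a :: c) x <-> 0 < dot a x /\ polycone c x.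
Proof.
split=> [H|[H1 H2] b]; last by rewrite inE => /orP[/eqP->//|/H2].
by split=> [|b bc]; apply: H; rewrite inE ?eqxx ?bc ?orbT.
Qed.

Lemma polycone_cat c d x : polycone (c ++ d) x <-> polycone c x /\ polycone d x.
Proof.
split=> [H|[Hc Hd] a]; last by rewrite mem_cat => /orP[/Hc|/Hd].
by split=> a ad; apply: H; rewrite mem_cat ad ?orbT.
Qed.

Lemma polycone_neq0 c x : c != [::] -> polycone c x -> x != 0.
Proof.
case: c => // a c _ /polycone_cons[+ _]; apply: contraTneq => ->.
by rewrite dot0r ltxx.
Qed.

Lemma polycone_perturb c x w : polycone c x ->
  exists2 d : R, 0 < d & forall e, `|e| < d -> polycone c (x + e *: w).
Proof.
elim: c => [_|a c IH /polycone_cons[ax /IH[d d0 dP]]]; first by exists 1.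
(* For [e] below this bound, [e * dot a w] stays below [dot a x]; the [1 +] keeps the denominator
   positive. *)
pose d' := dot a x / (1 + `|dot a w|).
have d'0 : 0 < d' by rewrite divr_gt0// ltr_pwDl.
exists (Num.min d d'); first by rewrite lt_min d0.
move=> e; rewrite lt_min => /andP[ed ed']; apply/polycone_cons; split; last exact: dP.
rewrite dotDr dotZr -ltrBlDl sub0r.
have : `|e * dot a w| < dot a x.
  rewrite normrM (@le_lt_trans _ _ (`|e| * (1 + `|dot a w|)))//.
    by rewrite ler_wpM2l// lerDr.
  by rewrite -ltr_pdivlMr// ltr_pwDl.
by rewrite ltr_norml => /andP[].
Qed.

(* Projection along [d]: a form that is positive on [d] gives a lower bound for
   [t] in [x + t *: d], a negative one an upper bound. *)
Definition sweep (d : V) (c : seq V) : seq V :=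
  [seq a <- c | dot a d == 0] ++
  [seq dot p d *: q - dot q d *: p
     | p <- [seq a <- c | 0 < dot a d], q <- [seq a <- c | dot a d < 0]].

Lemma exists_between (s t : seq R) :
  (forall x y, x \in s -> y \in t -> x < y) ->
  exists z, (forall x, x \in s -> x < z) /\ (forall y, y \in t -> z < y).
Proof.
elim: s => [|x s IH] H.
  elim: t {H} => [|y t [z [_ zt]]]; first by exists 0.
  exists (Num.min z y - 1); split=> // w; rewrite inE => /orP[/eqP->|/zt zw].
    by rewrite ltrBlDr (@le_lt_trans _ _ y) ?ge_min ?lexx ?orbT// ltrDl.
  by rewrite ltrBlDr (@le_lt_trans _ _ z) ?ge_min ?lexx// (lt_trans zw)// ltrDl.
have [|z [zs zt]] := IH; first by move=> u y us; apply: H; rewrite inE us orbT.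
have [xz|zx] := ltP x z.
  by exists z; split=> // u; rewrite inE => /orP[/eqP->//|/zs].
(* Here [z <= x], so whatever exceeds [x] exceeds the rest of the first list; only [x] and [t]
   matter. *)
suff [w [xw wt]] : exists w, x < w /\ forall y, y \in t -> w < y.
  exists w; split=> // u; rewrite inE => /orP[/eqP->//|/zs uz].
  by rewrite (lt_trans uz)// (le_lt_trans zx).
have {IH zs zt zx} : forall y, y \in t -> x < y by move=> y; apply: H; rewrite inE eqxx.
elim: t {H} => [_|y t IH H]; first by exists (x + 1); rewrite ltrDl.
have [|w [xw wt]] := IH; first by move=> u ut; apply: H; rewrite inE ut orbT.
have xy : x < y by apply: H; rewrite inE eqxx.
exists (Num.min w ((x + y) / 2)); split.
  by rewrite lt_min xw midf_lt.
move=> u; rewrite inE => /orP[/eqP->|/wt wu].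
  by rewrite gt_min midf_lt ?orbT.
by rewrite gt_min wu.
Qed.

(** Fourier-Motzkin: the forms for pairs say that every lower bound for [t] is less than every upper
    bound, so some [t] fits between. *)
Lemma sweepP d c x : polycone (sweep d c) x <-> exists t : R, polycone c (x + t *: d).
Proof.
split=> [/polycone_cat[c0 cpq]|[t ct]]; last first.
  apply/polycone_cat; split=> [a|a /allpairsP[[p q]/= []]].
    rewrite mem_filter => /andP[/eqP ad ac].
    by have := ct _ ac; rewrite dotDr dotZr ad mulr0 addr0.
  rewrite !mem_filter => /andP[pd pc] /andP[qd qc] ->.
  rewrite dotDl dotNl !dotZl.
  have := ct _ pc; have := ct _ qc; rewrite !dotDr !dotZr.
  set A := dot q x; set B := dot q d in qd *; set C := dot p x; set D := dot p d in pd *.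
  move=> H1 H2; nra.
pose low := [seq - dot p x / dot p d | p <- [seq a <- c | 0 < dot a d]].
pose upp := [seq - dot q x / dot q d | q <- [seq a <- c | dot a d < 0]].
have [|t [tlow tupp]] := @exists_between low upp.
  move=> _ _ /mapP[p pc ->] /mapP[q qc ->].
  have /cpq : dot p d *: q - dot q d *: p \in
      [seq dot p d *: q - dot q d *: p
     | p <- [seq a <- c | 0 < dot a d], q <- [seq a <- c | dot a d < 0]].
    by apply/allpairsP; exists (p, q).
  move: pc qc; rewrite !mem_filter dotDl dotNl !dotZl => /andP[pd _] /andP[qd _] H.
  rewrite ltr_ndivlMr// mulrAC ltr_pdivlMr//; lra.
exists t => a ac; rewrite dotDr dotZr.
have [ad|ad|ad] := ltgtP (dot a d) 0.
- have /tupp : - dot a x / dot a d \in upp.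
    by apply/mapP; exists a => //; rewrite mem_filter ad.
  by rewrite ltr_ndivlMr//; lra.
- have /tlow : - dot a x / dot a d \in low.
    by apply/mapP; exists a => //; rewrite mem_filter ad.
  by rewrite ltr_pdivrMr//; lra.
- by rewrite ad mulr0 addr0; apply: c0; rewrite mem_filter ad eqxx.
Qed.

(** New forms are positive combinations of old ones, so directions already eliminated stay
    eliminated. *)
Lemma sweep_coneh d c a : a \in sweep d c ->
  coneh [set` c] a /\ (dot a d = 0 /\ forall e, {in c, forall b, dot b e = 0} -> dot a e = 0).
Proof.
rewrite mem_cat => /orP[|/allpairsP[[p q]/= []]].
  rewrite mem_filter => /andP[/eqP ad ac]; split; first exact: sub_coneh.
  by split=> // e; apply.
rewrite !mem_filter => /andP[pd pc] /andP[qd qc] ->; split.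
  have [KD KZ] := coneh_conic [set` c].
  rewrite -scaleNr; apply: KD; first by apply: KZ => //; exact: sub_coneh.
  by apply: KZ; [rewrite oppr_gt0|exact: sub_coneh].
split=> [|e ce]; rewrite dotDl dotNl !dotZl; first by rewrite mulrC subrr.
by rewrite !ce// !mulr0 subr0.
Qed.

Definition sweeps (ds : seq V) (c : seq V) := foldr sweep c ds.

Lemma coneh_trans A B : A `<=` coneh B -> coneh A `<=` coneh B.
Proof.
move=> AB x [k [s [s0 _ sA ->]]]; apply: conic_lincomb => //; first exact: coneh_conic.
by apply: pos_in_sub sA => p _; exact: AB.
Qed.

Lemma sweeps_coneh ds c a : a \in sweeps ds c ->
  coneh [set` c] a /\ {in ds, forall d, dot a d = 0}.
Proof.
elim: ds a => [|d ds IH] a /=; first by move=> ac; split=> //; exact: sub_coneh.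
move=> /sweep_coneh[ac [ad ae]]; split.
  by apply: coneh_trans ac => b /= /IH[].
by move=> e; rewrite inE => /orP[/eqP->//|eds]; apply: ae => b /IH[_ /(_ _ eds)].
Qed.

Lemma sweepsP ds c x : polycone (sweeps ds c) x <->
  exists s : seq R, size s = size ds /\
    polycone c (x + \sum_(p <- zip s ds) p.1 *: p.2).
Proof.
elim: ds x => [|d ds IH] x /=.
  split=> [cx|[[|u s] [//]]]; last by rewrite big_nil addr0.
  by exists [::]; rewrite big_nil addr0.
rewrite sweepP; split=> [[t /IH[s [sd cx]]]|[[|t s] [//]]]; last move=> [sd].
  by exists (t :: s); split; [rewrite /= sd|rewrite big_cons addrA].
by rewrite big_cons addrA => cx; exists t; apply/IH; exists s.
Qed.

(** Eliminating all coordinate directions leaves only zero forms. If there is none, [0] solves the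
    swept system and lifts to a solution; otherwise the zero form is a positive combination of
    [c]. *)
Lemma gordan (c : seq V) : (exists v, polycone c v) \/ coneh [set` c] 0.
Proof.
pose es := [seq (delta_mx ord0 i : V) | i <- enum 'I_n].
have sw0 a : a \in sweeps es c -> a = 0.
  move=> /sweeps_coneh[_ ae]; apply/rowP => i; rewrite -dot_delta mxE; apply: ae.
  by apply/mapP; exists i => //; rewrite mem_enum.
case E : (sweeps es c) => [|a s].
  left; have /sweepsP[s [_ cs]] : polycone (sweeps es c) 0 by rewrite E.
  by eexists; exact: cs.
right; have ac : a \in sweeps es c by rewrite E inE eqxx.
by have [+ _] := sweeps_coneh ac; rewrite (sw0 _ ac).
Qed.

End Cones.

(** The sum is the projection of the pairs [(x, y)] with [x - y] in the first cone and [y] in the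
    second, hence polyhedral by elimination of [y]. *)
Lemma polycone_add (R : realType) (n : nat) (c d : seq 'rV[R]_n) :
  exists e : seq 'rV[R]_n, forall x, polycone e x <->
    exists y z, [/\ polycone c y, polycone d z & x = y + z].
Proof.
pose cd := [seq row_mx a (- a) | a <- c] ++ [seq row_mx 0 b | b <- d].
pose es := [seq (row_mx 0 (delta_mx ord0 i) : 'rV[R]_(n + n)) | i <- enum 'I_n].
exists [seq lsubmx a | a <- sweeps es cd] => x.
have cdP y : polycone cd (row_mx x y) <-> polycone c (x - y) /\ polycone d y.
  rewrite polycone_cat; split=> -[H1 H2]; split=> a.
  - move=> ac; have := H1 (row_mx a (- a)); rewrite dot_row_mx row_mxKl row_mxKr.
    by rewrite dotNl -dotNr -dotDr; apply; apply/mapP; exists a.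
  - move=> ad; have := H2 (row_mx 0 a); rewrite dot_row_mx row_mxKl row_mxKr dot0l.
    by rewrite add0r; apply; apply/mapP; exists a.
  - move=> /mapP[b bc ->]; rewrite dot_row_mx row_mxKl row_mxKr dotNl -dotNr -dotDr.
    exact: H1.
  - move=> /mapP[b bd ->]; rewrite dot_row_mx row_mxKl row_mxKr dot0l add0r.
    exact: H2.
have -> : polycone [seq lsubmx a | a <- sweeps es cd] x <->
          polycone (sweeps es cd) (row_mx x 0).
  split=> H a; last move=> /mapP[{}a + ->]; move=> ac.
    by rewrite dot_row_mx dot0r addr0; apply: H; apply/mapP; exists a.
  by have := H _ ac; rewrite dot_row_mx dot0r addr0.
rewrite sweepsP; split=> [[s [sz]]|[y [z [cy dz xyz]]]].
  (* Combinations of [es] have zero first block, so the elimination leaves [x] fixed. *)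
  have -> : \sum_(p <- zip s es) p.1 *: p.2 =
      row_mx 0 (rsubmx (\sum_(p <- zip s es) p.1 *: p.2)) :> 'rV[R]_(n + n).
    rewrite -[LHS]hsubmxK; congr row_mx.
    rewrite big_seq; elim/big_ind : _ => [|u v u0 v0|p].
    - by apply/rowP => i; rewrite !mxE.
    - by rewrite linearD/= u0 v0 addr0.
    - move=> /(map_f snd); rewrite -/unzip2 unzip2_zip ?sz// => /mapP[i _ ->].
      by rewrite linearZ/= row_mxKl scaler0.
  rewrite add_row_mx addr0 add0r => /cdP[cy dz].
  by eexists; eexists; split; [exact: cy|exact: dz|rewrite subrK].
exists [seq z ord0 i | i <- enum 'I_n]; split; first by rewrite !size_map.
have -> : \sum_(p <- zip [seq z ord0 i | i <- enum 'I_n] es) p.1 *: p.2 = row_mx 0 z.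
  rewrite /es; have -> : forall s : seq 'I_n,
      zip [seq z ord0 i | i <- s] [seq (row_mx 0 (delta_mx ord0 i) : 'rV[R]_(n + n)) | i <- s]
      = [seq (z ord0 i, row_mx 0 (delta_mx ord0 i)) | i <- s].
    by elim=> //= i s ->.
  rewrite big_map/= big_enum/= [in RHS](row_sum_delta z).
  transitivity (\sum_(i < n) row_mx (0 : 'rV[R]_n) (z ord0 i *: delta_mx ord0 i)).
    by apply: eq_bigr => i _; rewrite scale_row_mx scaler0.
  elim/big_rec2 : _ => [|i u v _ ->]; first by rewrite row_mx0.
  by rewrite add_row_mx addr0.
rewrite add_row_mx addr0 add0r; apply/cdP.
by rewrite xyz addrK.
Qed.

(** * Tameness in terms of positive combinations *)

Section Tame.
Variables (R : realType) (n : nat).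
Local Notation V := 'rV[R]_n.

(** Gordan's alternative does not bound the number of terms; adding up the coefficients of equal
    points bounds it by the number of points. *)
Lemma merge_terms (A : set V) (t : seq V) (s : seq (R * V)) :
  (forall p, p \in s -> p.2 \in t) -> pos_in A s ->
  exists s', [/\ (size s' <= size t)%N, pos_in A s', lincomb s' = lincomb s &
    s != [::] -> s' != [::]].
Proof.
elim: t s => [|a t IH] s st sA.
  by case: s st sA => [|p s] st sA; [exists [::]|have := st p (mem_head _ _)].
pose s1 := [seq p <- s | p.2 == a]; pose s2 := [seq p <- s | p.2 != a].
have split_s : lincomb s = lincomb s1 + lincomb s2.
  rewrite /s1 /s2 /lincomb !big_filter; exact: bigID.
have s2t p : p \in s2 -> p.2 \in t.
  by rewrite mem_filter => /andP[pa /st]; rewrite inE (negbTE pa).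
have s2A : pos_in A s2 by move=> p; rewrite mem_filter => /andP[_ /sA].
have [s' [s't s'A s's s'0]] := IH s2 s2t s2A.
have s1E : lincomb s1 = (\sum_(p <- s1) p.1) *: a.
  rewrite /lincomb scaler_suml big_seq [RHS]big_seq; apply: eq_bigr => p.
  by rewrite mem_filter => /andP[/eqP->].
have [s10|s10] := eqVneq s1 [::].
  exists s'; split=> //; first exact: leqW.
    by rewrite s's split_s s10 {2}/lincomb big_nil add0r.
  move=> s0; apply: s'0; apply: contra s0 => /eqP s20.
  by have := count_predC (fun p : R * V => p.2 == a) s;
     rewrite -!size_filter -/s1 -/s2 s10 s20 => /esym/eqP; rewrite size_eq0.
exists ((\sum_(p <- s1) p.1, a) :: s'); split=> //; last first.
  by rewrite split_s -s's s1E {1}/lincomb big_cons.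
case Es : s1 s10 => [//|q s1'] _.
have s1A p : p \in s1 -> 0 < p.1 /\ p.2 = a /\ A p.2.
  by rewrite mem_filter => /andP[/eqP pa /sA[p0 Ap]].
apply/pos_in_cons; split=> //=; rewrite -Es; split; last first.
  by have [_ [<- ]] : 0 < q.1 /\ q.2 = a /\ A q.2 by apply: s1A; rewrite Es mem_head.
rewrite Es big_cons ltr_pwDl//.
  by have [] : 0 < q.1 /\ q.2 = a /\ A q.2 by apply: s1A; rewrite Es mem_head.
rewrite big_seq sumr_ge0// => p ps; apply: ltW.
by have [] : 0 < p.1 /\ p.2 = a /\ A p.2 by apply: s1A; rewrite Es inE ps orbT.
Qed.

Lemma card_seq (T : eqType) (s : seq T) : [set` s] #<= `I_(size s).
Proof.
case: s => [|a s]; first by rewrite (_ : [set` _] = set0) ?card_le0// set_nil.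
have -> : [set` a :: s] = (fun i => nth a (a :: s) i) @` `I_(size (a :: s)).
  apply/seteqP; split=> [x /= xs|_ [i /= si <-]]; last exact: mem_nth.
  by exists (index x (a :: s)); [rewrite /mkset index_mem|exact: nth_index].
exact: card_image_le.
Qed.

Lemma tame_conek m (U : set V) : tame m U -> ~ conek m U 0.
Proof.
move=> [_ tU] [s [s0 sm sU /esym ls]].
have [|v _ Fv] := tU [set` [seq p.2 | p <- s]].
  split=> [x /= /mapP[p /sU[_ Up] ->]//||].
    by case: s s0 {sm sU ls} => // p s _; exists p.2; rewrite /= inE eqxx.
  by apply: card_le_trans (card_seq _) _; rewrite card_le_II size_map.
suff : 0 < dot (lincomb s) v by rewrite ls dot0l ltxx.
apply: (@dot_lincomb_gt0 _ _ [set x | 0 < dot x v]) => //.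
by move=> p ps; split; [case: (sU p ps)|apply: (Fv p.2 _).2; apply: map_f].
Qed.

(** Gordan's alternative for an enumeration of [F] gives a common hemisphere or a balanced
    combination, which merging shortens to at most [m] terms. *)
Lemma conek_tame m (U : set V) : U `<=` @sphere R n -> ~ conek m U 0 -> tame m U.
Proof.
move=> US nU; split=> // F [FU [x0 Fx0] Fm].
have [k kF] : exists k, F #= `I_k by apply/finite_setP; exact: card_le_finite Fm (finite_II m).
have km : (k <= m)%N by rewrite -card_le_II -(card_le_eql kF).
have /card_set_bijP[f [fF finj fsurj]] : `I_k #= F by rewrite card_eq_sym.
pose t := [seq f i | i <- iota 0 k].
have tF x : x \in t <-> F x.
  split=> [/mapP[i]|/fsurj[i ik <-]]; last by apply: map_f; rewrite mem_iota.
  by rewrite mem_iota add0n => /= ik ->; exact: fF.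
have [[v tv]|[k' [s [s0 _ st ls]]]] := gordan t.
  have vpos x : F x -> 0 < dot x v by move=> /tF; exact: tv.
  have v0 : v != 0 by apply: contraTneq (vpos _ Fx0) => ->; rewrite dot0r ltxx.
  exists (normalize v); first exact: normalize_sphere.
  move=> x Fx; split; first exact/US/FU.
  by rewrite /normalize dotZr mulr_gt0 ?vpos// sqrt_dot_gt0.
case: nU.
have [|s' [s't s'A s's s'0]] := @merge_terms [set` t] t s _ st.
  by move=> p /st[].
exists s'; split; [exact: s'0| |by apply: pos_in_sub s'A => p _ /tF/FU|by rewrite s's].
by rewrite (leq_trans s't)// size_map size_iota.
Qed.

End Tame.

(** * Topology of the sphere and of its conic subsets *)

Section Topology.
Variables (R : realType) (n : nat).
Local Notation V := 'rV[R]_n.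
Local Notation S := (@sphere R n).

Lemma cvg_dot (T : Type) (F : set_system T) (FF : Filter F) (f g : T -> V) (a b : V) :
  f @ F --> a -> g @ F --> b -> (dot (f t) (g t)) @[t --> F] --> dot a b.
Proof.
move=> fa gb; apply: cvg_big => [|i _]; first exact: add_continuous.
apply: cvgM; first exact: (cvg_comp _ _ fa (@coord_continuous _ _ _ _ _ a)).
exact: (cvg_comp _ _ gb (@coord_continuous _ _ _ _ _ b)).
Qed.

Lemma dot_continuous (v : V) : continuous (fun x => dot x v).
Proof.
by move=> x; apply: (@cvg_dot V (nbhs x) _ id (fun=> v)); [exact: cvg_id|exact: cvg_cst].
Qed.

Lemma sqnorm_continuous : continuous (fun x : V => dot x x).
Proof. by move=> x; apply: (@cvg_dot V (nbhs x) _ id id); exact: cvg_id. Qed.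

Lemma cvg_normalize (T : Type) (F : set_system T) (FF : Filter F) (f : T -> V) (a : V) :
  a != 0 -> f @ F --> a -> (normalize (f t)) @[t --> F] --> normalize a.
Proof.
move=> a0 fa; apply: cvgZ => //; apply: cvgV.
  by rewrite gt_eqF// sqrtr_gt0 dot_gt0.
apply: (@cvg_comp _ _ _ _ Num.sqrt _ (nbhs (dot a a))); last exact: sqrt_continuous.
exact: cvg_dot.
Qed.

Lemma closed_sphere : closed S.
Proof.
rewrite (_ : S = (fun x : V => dot x x) @^-1` [set x | x = 1])//.
by apply: preimage_closed; [move=> x _; exact: sqnorm_continuous|exact: closed_eq].
Qed.

Lemma bounded_sphere : bounded_set S.
Proof.
exists 1; split=> // M M1 x Sx; rewrite /mkset [`|x|]/Num.norm/= mx_normrE.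
apply/bigmax_leP; split=> [|[i j] _ /=]; first exact: le_trans (ltW M1).
apply: le_trans (ltW M1).
rewrite ord1 -(@expr_le1 _ 2)// real_normK ?num_real// expr2 -Sx /dot (bigD1 j)//=.
by rewrite lerDl; apply: sumr_ge0 => k _; rewrite -expr2 sqr_ge0.
Qed.

Lemma compact_in_sphere (U : set V) : closed_in S U -> compact U.
Proof.
move=> [C cC ->]; apply: bounded_closed_compact; last first.
  by apply: closedI => //; exact: closed_sphere.
have [M [Mr MS]] := bounded_sphere.
by exists M; split=> // m /MS mS x [_ /mS].
Qed.

(** Segments from a fixed point [x] stay in [K], hence miss the origin, and can be normalized back
    to the sphere. *)
Lemma connected_conic (K : set V) : conic K -> ~ K 0 -> connected (S `&` K).
Proof.
move=> [KD KZ] K0; have [->|/set0P[x [Sx Kx]]] := eqVneq (S `&` K) set0.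
  exact: connected0.
pose g (y : V) (t : R) := (1 - t) *: x + t *: y.
have gK y t : (S `&` K) y -> t \in `[0, 1] -> K (g y t).
  move=> [Sy Ky]; rewrite in_itv/= le_eqVlt => /andP[/predU1P[<-|t0]].
    by rewrite /g subr0 scale1r scale0r addr0.
  rewrite le_eqVlt => /predU1P[->|t1]; first by rewrite /g subrr scale0r scale1r add0r.
  by apply: KD; apply: KZ; rewrite ?subr_gt0.
have g0 y t : (S `&` K) y -> t \in `[0, 1] -> g y t != 0.
  by move=> Ay /(gK _ _ Ay) Kg; apply/eqP => g0; apply: K0; rewrite -g0.
have -> : S `&` K = \bigcup_(y in S `&` K) ((fun t => normalize (g y t)) @` `[0, 1]).
  apply/seteqP; split=> [y Ay|_ [y Ay [t /= t01 <-]]].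
    exists y => //; exists 1; first by rewrite /= in_itv/= lexx ler01.
    by rewrite /= /g subrr scale0r scale1r add0r normalize_id//; case: Ay.
  split; first exact/normalize_sphere/g0.
  by apply: KZ; [apply/sqrt_dot_gt0/g0|exact: gK].
apply: bigcup_connected => [|y Ay].
  exists x => y Ay; exists 0; first by rewrite /= in_itv/= lexx ler01.
  by rewrite /= /g subr0 scale1r scale0r addr0 normalize_id.
apply: connected_continuous_connected; first exact: segment_connected.
apply: continuous_in_subspaceT => t; rewrite inE/= => t01.
apply: cvg_normalize; first exact: g0.
apply: cvgD; apply: cvgZ; [|exact: cvg_cst| |exact: cvg_cst].
  by apply: cvgB => //; exact: cvg_cst.
exact: cvg_id.
Qed.

Lemma finite_components (I : eqType) (s : seq I) (A : I -> set V) (W : set V) :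
  (forall i, i \in s -> connected (A i)) ->
  (forall x, W x <-> exists2 i, i \in s & A i x) -> finite_set (components W).
Proof.
move=> cA WA.
(* A non-empty [A i] lies in one component, named by a chosen point of [A i]; the default [0]
   concerns only an empty [A i]. *)
apply: (@sub_finite_set _ _ ((fun i => connected_component W (xget 0 (A i))) @` [set` s])).
  move=> _ [x Wx <-]; have [i si Aix] := (WA x).1 Wx.
  exists i => //; apply: same_connected_component.
  have Aiz : A i (xget 0 (A i)) by apply: xgetPex; exists x.
  apply: (connected_component_max Aiz) (cA _ si) _ Aix => y Aiy.
  by apply/WA; exists i.
by apply: finite_image; exact: finite_seq.
Qed.

(** The cone over an open ball in the library norm; it is convex because balls of any norm are. *)
Definition cone_over (p : V) (e : R) : set V :=
  [set x | exists2 t : R, 0 < t & `|t *: x - p| < e].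

Lemma cone_over_conic p e : conic (cone_over p e).
Proof.
split=> [x y [t t0 tx] [u u0 uy]|a x a0 [t t0 tx]]; last first.
  by exists (t / a); [exact: divr_gt0|rewrite scalerA divfK// gt_eqF].
have tu : 0 < t + u by exact: addr_gt0.
(* This scale makes the sum a convex combination of [t *: x] and [u *: y], both in the ball. *)
exists (t * u / (t + u)); first exact: divr_gt0 (mulr_gt0 t0 u0) tu.
have -> : (t * u / (t + u)) *: (x + y) - p =
    (u / (t + u)) *: (t *: x - p) + (t / (t + u)) *: (u *: y - p).
  apply/rowP => i; rewrite !mxE; field.
  by rewrite gt_eqF.
have u'0 : 0 < u / (t + u) by exact: divr_gt0.
have t'0 : 0 < t / (t + u) by exact: divr_gt0.
apply: (le_lt_trans (ler_normD _ _)); rewrite !normrZ !gtr0_norm ?invr_gt0//.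
have -> : e = u / (t + u) * e + t / (t + u) * e by field; rewrite gt_eqF.
by rewrite ltrD// ltr_pM2l.
Qed.

Lemma cone_over_mem p e : 0 < e -> cone_over p e p.
Proof. by move=> e0; exists 1 => //; rewrite scale1r subrr normr0. Qed.

Lemma cone_over0 p e : cone_over p e 0 -> `|p| < e.
Proof. by move=> [t _]; rewrite scaler0 sub0r normrN. Qed.

Lemma open_cone_over p e : open (cone_over p e).
Proof.
rewrite (_ : cone_over p e = \bigcup_(t in [set t : R | 0 < t])
    ((fun x => `|t *: x - p|) @^-1` [set z | z < e])); last first.
  by apply/seteqP; split=> x [t t0 tx]; exists t.
apply: bigcup_open => t _; apply: open_comp; last exact: open_lt.
move=> x _.
have : t *: y - p @[y --> x] --> t *: x - p.
  apply: (@cvgB _ _ _ (nbhs x) _ (fun y => t *: y) (fun=> p)); last exact: cvg_cst.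
  exact: scaler_continuous.
by move/cvg_norm.
Qed.

(** Openness on the sphere is traded for a full ball followed by normalization, which permits
    additive perturbations. *)
Lemma open_in_near (U : set V) x : open_in S U -> U x ->
  exists2 e : R, 0 < e & forall y, `|y - x| < e -> y != 0 /\ U (normalize y).
Proof.
move=> [D oD UD] Ux; have [Dx Sx] : (D `&` S) x by rewrite -UD.
have x0 := sphere_neq0 Sx.
have nO : \forall y \near x, D (normalize y).
  have /(_ D) : normalize y @[y --> x] --> normalize x.
    by apply: (@cvg_normalize V (nbhs x) _ id) => //; exact: cvg_id.
  by apply; rewrite normalize_id//; exact: open_nbhs_nbhs.
have [e e0 eD] : exists2 e : R, 0 < e & forall y, `|y - x| < e -> D (normalize y).
  by move/nbhs_normP : nO => [e /= e0 eD]; exists e => // y yx; apply: eD; rewrite /= distrC.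
(* The bound by the norm of [x] keeps [y] away from the origin. *)
exists (Num.min e `|x|); first by rewrite lt_min e0 normr_gt0.
move=> y; rewrite lt_min => /andP[ye yx].
have y0 : y != 0 by apply: contraTneq yx => ->; rewrite sub0r normrN ltxx.
by split=> //; rewrite UD; split; [exact: eD|exact: normalize_sphere].
Qed.

(** The cone over a small ball meets the sphere in a connected subset of [U] containing [x]. *)
Lemma component_near (U : set V) x : open_in S U -> U x ->
  exists2 e : R, 0 < e &
    forall y, `|y - x| < e -> connected_component U x (normalize y).
Proof.
move=> oU Ux; have [e e0 eU] := open_in_near oU Ux; exists e => // y yx.
have K0 : ~ cone_over x e 0.
  by move=> /cone_over0 xe; have [|/eqP] := eU 0; rewrite ?sub0r ?normrN.
have [D _ UD] := oU; have [_ Sx] : (D `&` S) x by rewrite -UD.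
have Kx : (S `&` cone_over x e) x by split=> //; exact: cone_over_mem.
apply: (connected_component_max Kx) => [z [Sz [t t0 /eU[_]]]||].
- rewrite /normalize dotZl dotZr Sz mulr1 -expr2 sqrtr_sqr gtr0_norm// scalerA.
  by rewrite mulVf ?scale1r// gt_eqF.
- exact: connected_conic (cone_over_conic _ _) K0.
- have [y0 _] := eU y yx; split; first exact: normalize_sphere.
  have c0 := sqrt_dot_gt0 y0.
  exists (Num.sqrt (dot y y))^-1^-1; first by rewrite invr_gt0.
  by rewrite /normalize scalerA mulVf ?scale1r// gt_eqF.
Qed.

Lemma tame_hemisphere m (U : set V) (x : 'I_m -> V) : (0 < m)%N ->
  tame m U -> (forall i, U (x i)) -> exists v, forall i, 0 < dot (x i) v.
Proof.
case: m x => // m x _ [_ tU] Ux.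
have [|v _ vx] := tU [set` [seq x i | i <- enum 'I_m.+1]].
  split=> [_ /mapP[i _ ->]//||]; first by exists (x ord0) => /=; apply: map_f; rewrite mem_enum.
  by apply: card_le_trans (card_seq _) _; rewrite card_le_II size_map size_enum_ord.
by exists v => i; apply: (vx (x i) _).2; apply: map_f; rewrite mem_enum.
Qed.

(** A hemisphere of one tuple also serves nearby tuples; compactness of the space of [m]-tuples in
    [U] makes the radius uniform. *)
Lemma uniform_hemisphere m (U : set V) : (0 < m)%N -> tame m U -> compact U ->
  exists2 e : R, 0 < e & forall x y : 'I_m -> V, (forall i, U (x i)) ->
    (forall i, `|y i - x i| < e) -> exists v, forall i, 0 < dot (y i) v.
Proof.
move=> m0 tU cU.
pose P (e : R) (M : 'rV[V]_m) := forall y : 'I_m -> V,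
  (forall i, `|y i - M ord0 i| < e) -> exists v, forall i, 0 < dot (y i) v.
suff nP : \forall e \near (0 : R)^'+,
    [set M : 'rV[V]_m | forall i, U (M ord0 i)] `<=` P e.
  near (0 : R)^'+ => e; exists e; first by near: e; exact: nbhs_right_gt.
  move=> x y Ux yx.
  have eP : [set M : 'rV[V]_m | forall i, U (M ord0 i)] `<=` P e by near: e.
  by apply: (eP (\row_i x i)) => i; rewrite mxE.
have /compact_near_coveringP := @rV_compact _ m (fun=> U) (fun _ => cU).
apply => M UM.
have [v vM] := tame_hemisphere m0 tU UM.
have /fin_all_exists2[d d0 dP] i : exists2 d : R,
    0 < d & forall z, `|z - M ord0 i| < d -> 0 < dot z v.
  have : \forall z \near M ord0 i, 0 < dot z v.
    have /(_ (M ord0 i)) := @dot_continuous v.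
    move=> /(_ [set z | 0 < z]); apply; apply: open_nbhs_nbhs.
    by split; [exact: open_gt|exact: vM].
  by move=> /nbhs_normP[d /= d0 dP]; exists d => // z zM; apply: dP; rewrite /= distrC.
(* Half of a lower bound for the [d i]: the moves from [M] to [M'] and from [M'] to [y] together
   stay within [d i]. *)
pose e := (\big[Num.min/1]_i d i) / 2.
have e0 : 0 < e by rewrite divr_gt0//; apply/bigmin_gtP; split.
have ed i : e + e <= d i by rewrite -splitr; exact: bigmin_le.
have nb (w : V) : \forall z \near w, `|z - w| < e.
  by apply/nbhs_normP; exists e => // z /=; rewrite distrC.
exists ([set M' : 'rV[V]_m | forall i, `|M' ord0 i - M ord0 i| < e], [set e' | e' < e]) => /=.
  split; last exact: nbhs_right_lt.
  exists (fun i j => [set z | `|z - M ord0 j| < e]) => [i j|M' /= H i]; last exact: H.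
  by rewrite ord1; exact: nb.
move=> [M' e'] /= [M'M e'e] y yM'; exists v => i; apply: (dP i).
rewrite -(subrKA (M' ord0 i)) (le_lt_trans (ler_normD _ _))// (lt_le_trans _ (ed i))//.
by rewrite ltrD// (lt_trans (yM' i)).
Unshelve. all: by end_near. Qed.

End Topology.

(** * Finite enumerations and counting components *)

Lemma ord_enum_seq (T : eqType) (s : seq T) m : s != [::] -> (size s <= m)%N ->
  exists q : 'I_m -> T, (forall i, q i \in s) /\ (forall p, p \in s -> exists i, q i = p).
Proof.
(* The list is padded with its head up to [m] entries. *)
case: s => // p0 s _ sm; exists (fun i => nth p0 (p0 :: s) i); split=> [i|p ps].
  have [si|si] := ltnP i (size (p0 :: s)); first exact: mem_nth.
  by rewrite nth_default// mem_head.
have pm : (index p (p0 :: s) < m)%N by apply: leq_trans sm; rewrite index_mem.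
by exists (Ordinal pm) => /=; exact: nth_index.
Qed.

(** Pigeonhole. The right side tests [k.+1] points at a time, which lets the bound pass to unions of
    chains. *)
Lemma components_leP (T : topologicalType) (X : set T) k : components X #<= `I_k <->
  forall x : 'I_k.+1 -> T, (forall i, X (x i)) ->
    exists i j, i != j /\ connected_component X (x i) (x j).
Proof.
have compP x : X x -> components X (connected_component X x) by move=> Xx; exists x.
split=> [/pcard_leP[f] x Xx|H].
  have fk i : (f (connected_component X (x i)) < k)%N.
    by have : `I_k (f (connected_component X (x i))) by apply: funS; exact: compP.
  have /injectivePn[i [j ij [fij]]] : ~~ injectiveb (fun i => Ordinal (fk i)).
    by apply/negP => /injectiveP/leq_card; rewrite !card_ord ltnn.
  exists i, j; split=> //.
  have -> : connected_component X (x i) = connected_component X (x j).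
    by apply: (@inj _ _ _ f) fij; exact/mem_set/compP.
  exact: connected_component_refl.
apply: contrapT => nk.
have /pcard_leP[f] : `I_k.+1 #<= components X.
  have [/finite_setP[m mX]|/infiniteP XN] := pselect (finite_set (components X)).
    rewrite (card_le_eqr mX) card_le_II ltnNge; apply/negP => mk; apply: nk.
    by rewrite (card_le_eql mX) card_le_II.
  exact: card_le_trans (card_leT _) XN.
have /fin_all_exists2[x Xx fx] (i : 'I_k.+1) :
    exists2 x, X x & connected_component X x = f i.
  have [y Xy yf] : components X (f i) by apply: funS; exact: ltn_ord.
  by exists y.
have [i [j [/eqP ij /same_connected_component]]] := H x Xx.
rewrite !fx => fij; apply: ij; apply/val_inj.
by apply: (@inj _ _ _ f) fij; exact/mem_set/ltn_ord.
Qed.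

Lemma connected_component_mono (T : topologicalType) (A B : set T) x :
  A `<=` B -> connected_component A x `<=` connected_component B x.
Proof. by move=> AB y [C [Cx CA cC] Cy]; exists C => //; split=> // z /CA/AB. Qed.

(** * Thickening closed sets, and Zorn's lemma *)

Section Enlarge.
Variables (R : realType) (n : nat).
Local Notation V := 'rV[R]_n.
Local Notation S := (@sphere R n).

(** [W] is the trace of finitely many cones over balls of the uniform radius: any [n] points of [W]
    are, up to scale, close to [n] points of [U]. *)
Lemma closed_enlarge (U : set V) : (0 < n)%N -> closed_in S U -> tame n U ->
  exists W : set V, [/\ open_in S W, tame n W, finite_set (components W) & U `<=` W].
Proof.
move=> n0 clU tU; have US : U `<=` S by case: tU.
have cU := compact_in_sphere clU.
have [e e0 eP] := uniform_hemisphere n0 tU cU.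
(* Otherwise the constant tuple [p] could be moved to [0], which lies in no hemisphere. *)
have K0 p : U p -> ~ cone_over p e 0.
  move=> Up /cone_over0 pe.
  have [i|v /(_ (Ordinal n0))] := eP (fun=> p) (fun=> 0) (fun=> Up).
    by rewrite sub0r normrN.
  by rewrite dot0l ltxx.
have : finite_subset_cover U (fun p => cone_over p e) U.
  move: cU; rewrite compact_cover; apply=> [p Up|p Up]; first exact: open_cone_over.
  by exists p => //; exact: cone_over_mem.
move=> [D DU UD].
pose s : seq V := finmap.enum_fset D.
have {}DU p : p \in s -> U p by move=> ps; exact: set_mem (DU p ps).
have {}UD : U `<=` \bigcup_(p in [set` s]) cone_over p e.
  by move=> x /UD[p ps px]; exists p.
pose W := (\bigcup_(p in [set` s]) cone_over p e) `&` S.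
exists W; split.
- exists (\bigcup_(p in [set` s]) cone_over p e) => //.
  by apply: bigcup_open => p _; exact: open_cone_over.
- apply: conek_tame => [x []//|[t [t0 tn tW /esym lt]]].
  have [q [qt tq]] := ord_enum_seq t0 tn.
  have /fin_all_exists2[p Up pq] i : exists2 p, U p & cone_over p e (q i).2.
    by have [_ [[p /= /DU Up pq] _]] := tW _ (qt i); exists p.
  have /fin_all_exists2[a a0 aq] i : exists2 a : R, 0 < a & `|a *: (q i).2 - p i| < e.
    by have [a] := pq i; exists a.
  have [v vP] := eP p _ Up aq.
  suff : 0 < dot (lincomb t) v by rewrite lt dot0l ltxx.
  apply: (@dot_lincomb_gt0 _ _ [set x | 0 < dot x v]) => // r rt.
  split; first by have [] := tW _ rt.
  by have [i <-] := tq _ rt; have := vP i; rewrite dotZl pmulr_rgt0.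
- apply: (@finite_components _ _ _ s (fun p => S `&` cone_over p e)).
    move=> p pD; apply: connected_conic; first exact: cone_over_conic.
    exact/K0/DU.
  by move=> x; split=> [[[p pD px] Sx]|[p pD [Sx px]]]; [exists p|split=> //; exists p].
- by move=> x Ux; split; [exact: UD|exact: US].
Qed.

Lemma weakly_maxtame_above (U : set V) : open_in S U -> tame n U ->
  finite_set (components U) -> exists2 W : set V, weakly_maxtame W & U `<=` W.
Proof.
move=> oU tU /finite_setP[k Uk].
(* [P] concerns what is added to [U], so that the union of the empty chain satisfies it too. *)
pose P W := [/\ open_in S (U `|` W), tame n (U `|` W) & components (U `|` W) #<= `I_k].
have P0 : P set0 by split; rewrite setU0//; rewrite (card_le_eql Uk) card_lexx.
(* The conditions in [P] can be checked on finitely many points at a time, and finitely many points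
   of the union already occur at one stage of the chain. *)
have chain (F : set (set V)) (s : seq V) : F `<=` P -> total_on F subset ->
    (forall x, x \in s -> (U `|` \bigcup_(X in F) X) x) ->
    exists X, [/\ P X, X `<=` \bigcup_(X in F) X & forall x, x \in s -> (U `|` X) x].
  move=> FP totF sF.
  suff [X [[FX|X0] sX]] : exists X, (F X \/ X = set0) /\ forall x, x \in s -> (U `|` X) x.
  - by exists X; split=> //; [exact: FP|exact: bigcup_sup].
  - by exists X; split=> //; rewrite X0//; exact: sub0set.
  elim: s sF => [|y s IH] sF; first by exists set0; split=> //; right.
  have [|X [FX sX]] := IH; first by move=> x xs; apply: sF; rewrite inE xs orbT.
  have : (U `|` \bigcup_(X in F) X) y by apply: sF; exact: mem_head.
  move=> [Uy|[Y FY Yy]].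
    by exists X; split=> // x; rewrite inE => /predU1P[->|/sX//]; left.
  have [XY|YX] : X `<=` Y \/ Y `<=` X.
    by case: FX => [FX|->]; [exact: totF|left; exact: sub0set].
    exists Y; split; first by left.
    move=> x; rewrite inE => /predU1P[->|/sX[|/XY]]; by [right|left].
  exists X; split=> // x; rewrite inE => /predU1P[->|/sX//]; right; exact: YX.
have [F FP totF|A [[oA tA kA] maxA]] := @Zorn_bigcup _ P.
  set Z := \bigcup_(X in F) X; split.
  (* [D] collects all open sets whose trace on the sphere lies in the union. *)
  - pose D := \bigcup_(G in [set G : set V | open G /\ G `&` S `<=` U `|` Z]) G.
    exists D; first by apply: bigcup_open => G [].
    apply/seteqP; split=> x; last by move=> [[G [_ GZ] Gx] Sx]; exact: GZ.
    move=> Zx; have [|X [[[G oG UG] _ _] XZ Xx]] := chain F [:: x] FP totF.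
      by move=> y; rewrite inE => /eqP ->.
    have := Xx _ (mem_head _ _); rewrite UG => -[Gx Sx]; split=> //.
    by exists G => //; split=> //; rewrite -UG => y [Uy|/XZ Zy]; [left|right].
  - apply: conek_tame => [x Zx|[s [s0 sn sZ ls]]].
      have [|X [[_ [XS _] _] _ Xx]] := chain F [:: x] FP totF.
        by move=> y; rewrite inE => /eqP ->.
      exact/XS/Xx/mem_head.
    have [|X [[_ tX _] _ sX]] := chain F [seq p.2 | p <- s] FP totF.
      by move=> _ /mapP[p /sZ[_ Zp] ->].
    apply: (tame_conek tX); exists s; split=> // p ps.
    by split; [have [] := sZ _ ps|apply: sX; exact: map_f].
  - apply/components_leP => x Zx.
    have [|X [[_ _ /components_leP kX] XZ Xx]] := chain F [seq x i | i <- enum 'I_k.+1] FP totF.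
      by move=> _ /mapP[i _ ->].
    have [|i [j [ij xij]]] := kX x; first by move=> i; apply: Xx; apply: map_f; rewrite mem_enum.
    exists i, j; split=> //; apply: connected_component_mono xij => y [Uy|/XZ Zy]; by [left|right].
exists (U `|` A); last by left.
split=> //; first exact: card_le_finite kA (finite_II k).
move=> X oX tX kX AX.
have UX : U `|` X = X by apply/setUidPr => x Ux; apply: AX; left.
have PX : P X by split; rewrite UX//; exact: card_le_trans kX kA.
apply/seteqP; split=> // x Xx; right; apply: contrapT => nAx.
apply: (maxA X) => //; split=> [y Ay|XA]; first by apply: AX; right.
by apply: nAx; exact: XA.
Qed.

End Enlarge.

(** * Components and common hemispheres *)

Section FenchelBunt.
Variables (R : realType) (n : nat).
Local Notation V := 'rV[R]_n.
Local Notation S := (@sphere R n).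

(** Caratheodory's reduction: a multiple of the second relation is subtracted from the first. As
    [m i0 = 0], the term [i0] survives and the list stays non-empty. *)
Lemma conek_reduce (A : set V) r (x : 'I_r -> V) (l m : 'I_r -> R) i0 j0 :
  (forall i, A (x i)) -> (forall i, 0 < l i) ->
  \sum_i l i *: x i = 0 -> \sum_i m i *: x i = 0 ->
  m i0 = 0 -> m j0 != 0 -> conek r.-1 A 0.
Proof.
move=> Ax l0 lx mx mi0 mj0.
wlog {mj0} mj0 : m mx mi0 / 0 < m j0 => [H|].
  have [mj|mj] := ltP 0 (m j0); first exact: (H m).
  apply: (H (fun i => - m i)); rewrite ?mi0 ?oppr0//.
    by under eq_bigr do rewrite scaleNr; rewrite sumrN mx oppr0.
  by rewrite oppr_gt0 lt_neqAle mj0.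
(* The least ratio kills the term [j] and makes no coefficient negative. *)
case: (@arg_minP _ _ _ j0 (fun j => 0 < m j) (fun j => l j / m j) mj0) => j mj jmin.
pose nu i := l i - l j / m j * m i.
have nuj : nu j = 0 by rewrite /nu divfK ?subrr// gt_eqF.
have nu0 i : 0 <= nu i.
  rewrite /nu subr_ge0; have [mi|mi] := ltP 0 (m i).
    by rewrite -ler_pdivlMr//; exact: jmin.
  apply: le_trans (ltW (l0 i)); apply: mulr_ge0_le0 => //.
  by rewrite divr_ge0// ltW.
exists [seq (nu i, x i) | i <- enum 'I_r & 0 < nu i]; split.
- rewrite -size_eq0 size_map size_filter -lt0n -has_count; apply/hasP.
  by exists i0; rewrite ?mem_enum// /nu mi0 mulr0 subr0.
- rewrite size_map size_filter.
  have cr : (count (fun i => 0 < nu i)%R (enum 'I_r) < r)%N.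
    rewrite -[X in (_ < X)%N](size_enum_ord r).
    rewrite -(count_predC (fun i => 0 < nu i) (enum 'I_r)) -addn1 leq_add2l -has_count.
    by apply/hasP; exists j; rewrite ?mem_enum//= nuj ltxx.
  by rewrite -ltnS (ltn_predK cr).
- move=> p /mapP[i]; rewrite mem_filter => /andP[i0' _] ->; split=> //=; exact: Ax.
- rewrite /lincomb big_map big_filter big_enum_cond/=.
  transitivity (\sum_i nu i *: x i); last first.
    rewrite [RHS]big_mkcond/=; apply: eq_bigr => i _; case: ifPn => // nui.
    by have /eqP -> : nu i == 0; [rewrite eq_le nu0 leNgt nui|rewrite scale0r].
  under eq_bigr do rewrite scalerBl -scalerA.
  by rewrite sumrB lx -scaler_sumr mx scaler0 subr0.
Qed.

(* Minus the cone on the rows of [X] contains one point of [C] but not the row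
   [k] of [X]; its boundary misses [U], so it is clopen in [C]. *)
Lemma connected_simplex (U C : set V) (X : 'M[R]_n) (x : V) k :
  ~ conek n U 0 -> connected C -> C `<=` U -> X \in unitmx ->
  (forall i, U (row i X)) -> C x -> C (row k X) ->
  (forall i, (x *m invmx X) ord0 i < 0) -> False.
Proof.
move=> nU cC CU uX XU Cx Ck x0.
(* The basis dual to the rows of [X]: [dot w (g i)] is the coordinate of [w] along row [i]. *)
pose g i : V := (col i (invmx X))^T.
have gE w i : (w *m invmx X) ord0 i = dot w (g i).
  by rewrite mxE; apply: eq_bigr => j _; rewrite !mxE.
pose D := C `&` [set w | forall i, dot w (g i) < 0].
have DE : D = C `&` \bigcap_i [set w | dot w (g i) <= 0].
  apply/seteqP; split=> w [Cw wg]; split=> // i; first by move=> _; exact/ltW/wg.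
  rewrite lt_neqAle; have /= -> := wg i I; rewrite andbT.
  apply/negP => /eqP wi0; apply: nU.
  pose c j := dot w (g j).
  (* Coordinate [i] of [w] vanishes, so at most [n - 1] rows, those with negative coordinate,
     balance [w]. *)
  exists ((1, w) :: [seq (- c j, row j X) | j <- enum 'I_n & c j < 0]); split=> //.
  - rewrite /= size_map size_filter -[X in (_ < X)%N](size_enum_ord n).
    rewrite -(count_predC (fun j => c j < 0) (enum 'I_n)) -addn1 leq_add2l -has_count.
    by apply/hasP; exists i; rewrite ?mem_enum//= /c wi0 ltxx.
  - apply/pos_in_cons; split; first by split=> //; exact: CU.
    move=> p /mapP[j]; rewrite mem_filter => /andP[cj _] ->; split; last exact: XU.
    by rewrite oppr_gt0.
  - rewrite /lincomb big_cons scale1r big_map big_filter big_enum_cond/=.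
    rewrite -{1}(mulmxKV uX w) mulmx_sum_row/=; apply/esym/eqP.
    rewrite [X in _ + X == _](_ : _ = - \sum_i (w *m invmx X) ord0 i *: row i X) ?subrr//.
    rewrite -sumrN big_mkcond/=; apply: eq_bigr => j _; rewrite gE -/(c j).
    case: ifPn => cj; first by rewrite scaleNr.
    have cj0 : c j <= 0 by exact: (wg j I).
    have -> : c j = 0 by apply/eqP; rewrite eq_le cj0 leNgt.
    by rewrite scale0r oppr0.
have DC : D = C.
  apply: cC; first by exists x; split=> // i; rewrite -gE.
    exists [set w | forall i, dot w (g i) < 0] => //.
    rewrite openE => w wg.
    apply: (@filter_forall V 'I_n (fun i => [set w | dot w (g i) < 0]) (nbhs w)) => i.
    have /(_ w) := @dot_continuous R n (g i).
    move=> /(_ [set z | z < 0]); apply; apply: open_nbhs_nbhs.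
    by split; [exact: open_lt|exact: wg].
  exists (\bigcap_i [set w | dot w (g i) <= 0]) => //.
  apply: closed_bigI => i _.
  rewrite (_ : [set w | _] = (fun w => dot w (g i)) @^-1` [set z | z <= 0])//.
  by apply: preimage_closed; [move=> w _; exact: dot_continuous|exact: closed_le].
have : D (row k X) by rewrite DC.
move=> [_ /(_ k)]; rewrite -gE -row_mul mulmxV// !mxE eqxx.
by rewrite ltNge ler01.
Qed.

(** A shortest balanced list has more than [n] points, so two of them share a component. By
    minimality the points other than one of these two are independent, hence a basis, and
    [connected_simplex] applies. *)
Lemma components_unbalanced (U : set V) (I : 'I_n -> V) : ~ conek n U 0 ->
  ~ coneh [set x | exists i, connected_component U (I i) x] 0.
Proof.
move=> nU; set A := [set x | _]; move=> [k0 Ak0].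
have AU : A `<=` U by move=> x [i /connected_component_sub].
have ex : exists k, `[< conek k A 0 >] by exists k0; apply/asboolP.
case: (ex_minnP ex) => k1 /asboolP[s [s0 sk sA ls]] kmin.
have {k1 sk kmin} smin k : conek k A 0 -> (size s <= k)%N.
  by move=> Ak; apply: leq_trans sk _; apply: kmin; apply/asboolP.
have sn : (n < size s)%N.
  rewrite ltnNge; apply/negP => sn; apply: nU; exists s; split=> //.
  by apply: pos_in_sub sA => p _; exact: AU.
case Er : (size s) sn => [//|r] rn.
pose p (i : 'I_r.+1) := nth (0, 0) s i.
have ps i : p i \in s by apply: mem_nth; rewrite Er.
pose x i := (p i).2; pose l i := (p i).1.
have Ax i : A (x i) by have [] := sA _ (ps i).
have l0 i : 0 < l i by have [] := sA _ (ps i).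
have lx : \sum_i l i *: x i = 0.
  by rewrite [RHS]ls /lincomb (big_nth (0, 0)) Er big_mkord.
have /fin_all_exists[c cP] i : exists c : 'I_n, connected_component U (I c) (x i).
  exact: Ax.
have /injectivePn[i [j ij cij]] : ~~ injectiveb c.
  by apply/negP => /injectiveP/leq_card; rewrite !card_ord leqNgt rn.
pose M := \matrix_(k < r) x (lift i k).
have fM : row_free M.
  rewrite -kermx_eq0; apply/negP => /negP /rowV0Pn[mu /sub_kermxP muM mu0].
  have /rV0Pn[k muk] := mu0.
  (* The dependency gets coefficient [0] at [i], as the reduction requires. *)
  pose m a := if unlift i a is Some b then mu ord0 b else 0.
  have := @conek_reduce A _ x l m i (lift i k) Ax l0 lx.
  rewrite /m unlift_none liftK => H.
  have /smin : conek r.+1.-1 A 0.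
    apply: H => //; rewrite (bigD1_ord i)//= unlift_none scale0r add0r.
    rewrite -[RHS]muM mulmx_sum_row; apply: eq_bigr => b _.
    by rewrite liftK rowK.
  by rewrite Er ltnn.
have rn' : r = n.
  apply/eqP; rewrite eqn_leq [(n <= r)%N]rn andbT.
  by have := rank_leq_col M; rewrite (eqP fM).
subst r.
have uM : M \in unitmx by rewrite -row_free_unit.
have [k jk] : exists k, j = lift i k.
  by case: (unliftP i j) => [k ->|ji]; [exists k|rewrite ji eqxx in ij].
apply: (@connected_simplex U (connected_component U (I (c i))) M (x i) k) => //.
- exact: component_connected.
- exact: connected_component_sub.
- by move=> b; rewrite rowK; exact/AU.
- by rewrite rowK -jk cij; exact: cP.
- move=> b; pose l' : V := \row_b l (lift i b).
  (* Solving the balance relation for [x i] shows that its coordinates in the basis are negative. *)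
  have -> : x i = - (l i)^-1 *: (l' *m M).
    move: lx; rewrite (bigD1_ord i)//= mulmx_sum_row => /eqP; rewrite addr_eq0 => /eqP lxi.
    rewrite (eq_bigr (fun b => l (lift i b) *: x (lift i b))); last first.
      by move=> a _; rewrite mxE rowK.
    rewrite -[X in _ *: X]opprK -lxi scalerN scaleNr opprK scalerA.
    by rewrite mulVf ?scale1r// gt_eqF.
  by rewrite -scalemxAl mulmxK// !mxE mulNr oppr_lt0 mulr_gt0// invr_gt0.
Qed.

(** Gordan's alternative serves finitely many points, compactness of the sphere gives weak
    inequalities for all points, and openness of [U] makes them strict. *)
Lemma components_hemisphere (U : set V) (I : 'I_n -> V) : open_in S U -> tame n U ->
  exists v, forall i x, connected_component U (I i) x -> 0 < dot x v.
Proof.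
move=> oU tU; set A := [set x | exists i, connected_component U (I i) x].
have nA := components_unbalanced (tame_conek tU) : ~ coneh A 0.
have [/set0P[x0 Ax0]|/negP/negPn/eqP A0] := pselect (A != set0); last first.
  exists 0 => i x xi; suff : A x by rewrite A0.
  by exists i.
have AU : A `<=` U by move=> x [i /connected_component_sub].
have US : U `<=` S by case: tU.
have : \bigcap_(x in A) (S `&` [set v | 0 <= dot v x]) !=set0.
  have cS : compact S.
    by apply: compact_in_sphere; exists setT; rewrite ?setTI//; exact: closedT.
  move: cS; rewrite compact_In0; apply.
    exists (fun x => [set v | 0 <= dot v x]) => // x _.
    rewrite (_ : [set v | _] = (fun v => dot v x) @^-1` [set z | 0 <= z])//.
    by apply: preimage_closed; [move=> v _; exact: dot_continuous|exact: closed_ge].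
  move=> D DA.
  (* Including [x0] keeps the list non-empty, hence [v] non-zero. *)
  have [[v vP]|xA] := gordan (x0 :: finmap.enum_fset D); last first.
    exfalso; apply: nA; apply: coneh_trans xA => x /=.
    rewrite inE => /predU1P[->|xD]; first exact: sub_coneh.
    by apply: sub_coneh; apply: set_mem; exact: DA.
  have v0 : v != 0 by exact: polycone_neq0 vP.
  exists (normalize v) => x xD; split; first exact: normalize_sphere.
  rewrite /= /normalize dotZl mulr_ge0 ?ltW ?sqrt_dot_gt0//.
  by rewrite dotC; apply: vP; rewrite inE xD orbT.
move=> [v vA]; have [Sv _] := vA _ Ax0.
exists v => i x xi.
have Ux := connected_component_sub xi.
have [e e0 eU] := component_near oU Ux.
(* This makes [d *: v] shorter than [e]; as [v] is a unit vector, the weak inequality at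
   [x - d *: v] gives [d <= dot x v]. *)
pose d := e / 2 / (1 + `|v|).
have v1 : 0 < 1 + `|v| by rewrite ltr_pwDl.
have d0 : 0 < d by rewrite !divr_gt0.
have /eU xv : `|(x - d *: v) - x| < e.
  rewrite addrAC subrr sub0r normrN normrZ gtr0_norm//.
  apply: (@le_lt_trans _ _ (e / 2)); last by rewrite ltr_pdivrMr// ltr_pMr// ltr1n.
  by rewrite /d mulrAC ler_pdivrMr// ler_wpM2l ?divr_ge0 ?ltW// ltrDr.
have : A (normalize (x - d *: v)) by exists i; exact: connected_component_trans xi xv.
move=> /vA[_]; rewrite /= /normalize dotZr pmulr_rge0.
  by rewrite dotDr dotNr dotZr Sv mulr1 subr_ge0 dotC; exact: lt_le_trans.
rewrite sqrt_dot_gt0//; apply/eqP => xdv.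
by move: xv; rewrite xdv /normalize scaler0 => /connected_component_sub/US/sphere_neq0; rewrite eqxx.
Qed.

(** * Finite unions of open polyhedral cones *)

Definition polyunion (cs : seq (seq V)) : set V :=
  [set x | exists2 c, c \in cs & polycone c x].

(** A non-empty list of forms keeps the origin out of the cone; an inner point serves to push
    boundary points inside. *)
Definition proper_cones (cs : seq (seq V)) :=
  forall c, c \in cs -> c != [::] /\ exists x, polycone c x.

Lemma polyhedral_above (U : set V) : (0 < n)%N ->
  open_in S U -> tame n U -> finite_set (components U) ->
  exists cs, [/\ proper_cones cs, ~ conek n (polyunion cs) 0 & U `<=` polyunion cs].
Proof.
move=> n0 oU tU /finite_seqP[s sU].
have /fin_all_exists2[r Ur rE] (i : 'I_(size s)) :
    exists2 x, U x & connected_component U x = nth set0 s i.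
  have [x Ux xE] : components U (nth set0 s i) by rewrite sU; exact: mem_nth.
  by exists x.
pose k := size s.
have /fin_all_exists[gam gamP] (f : {ffun 'I_n -> 'I_k}) :
    exists v, forall i x, connected_component U (r (f i)) x -> 0 < dot x v.
  exact: components_hemisphere.
(* Cone [i] is cut out by the hemispheres of all tuples through [i], so [n] points in the cones of a
   tuple [f] lie in the hemisphere of [f]. *)
pose c (i : 'I_k) :=
  [seq gam f | f : {ffun 'I_n -> 'I_k} <- enum {: {ffun 'I_n -> 'I_k}} & i \in codom f].
have cP (f : {ffun 'I_n -> 'I_k}) j : gam f \in c (f j).
  by apply/mapP; exists f => //; rewrite mem_filter mem_enum codom_f.
have cU i x : connected_component U (r i) x -> polycone (c i) x.
  move=> xi a /mapP[f]; rewrite mem_filter => /andP[/codomP[j ij] _] ->.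
  by rewrite dotC; apply: (gamP f j); rewrite -ij.
exists [seq c i | i <- enum 'I_k]; split.
- move=> _ /mapP[i _ ->]; split.
    (* A constant tuple shows that [c i] is non-empty. *)
    have := cP [ffun=> i] (Ordinal n0); rewrite ffunE.
    by apply: contraTneq => ->.
  by exists (r i); apply: cU; exact: connected_component_refl.
- move=> [t [t0 tn tc /esym lt]].
  have [q [qt tq]] := ord_enum_seq t0 tn.
  have /fin_all_exists[f fP] j : exists i : 'I_k, polycone (c i) (q j).2.
    by have [_ [_ /mapP[i _ ->]]] := tc _ (qt j); exists i.
  suff : 0 < dot (lincomb t) (gam [ffun j => f j]) by rewrite lt dot0l ltxx.
  apply: (@dot_lincomb_gt0 _ _ [set x | 0 < dot x (gam [ffun j => f j])]) => // p pt.
  split; first by have [] := tc _ pt.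
  have [j <-] := tq _ pt; rewrite /= dotC; apply: fP.
  by have := cP [ffun j => f j] j; rewrite ffunE.
- move=> x Ux.
  have : components U (connected_component U x) by exists x.
  rewrite sU /= => xs.
  have i_lt : (index (connected_component U x) s < k)%N by rewrite index_mem.
  exists (c (Ordinal i_lt)); first by apply: map_f; rewrite mem_enum.
  by apply: cU; rewrite rE/= nth_index//; exact: connected_component_refl.
Qed.

End FenchelBunt.

(** * Free points and the adjunction of cones *)

Section Free.
Variables (R : realType) (n m : nat).
Local Notation V := 'rV[R]_n.
Local Notation S := (@sphere R n).

Definition polysum (c d : seq V) : seq V := projT1 (cid (polycone_add c d)).

Lemma polysumP c d x : polycone (polysum c d) x <->
  exists y z, [/\ polycone c y, polycone d z & x = y + z].
Proof. exact: (projT2 (cid (polycone_add c d)) x). Qed.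

(** Note the shift: stage [k] covers the sums of at most [k.+1] points. *)
Fixpoint hulls k (cs : seq (seq V)) : seq (seq V) :=
  if k is k'.+1 then hulls k' cs ++ [seq polysum c d | c <- cs, d <- hulls k' cs]
  else cs.

Lemma polyunionZ (cs : seq (seq V)) (a : R) x :
  0 < a -> polyunion cs x -> polyunion cs (a *: x).
Proof. by move=> a0 [c ccs cx]; exists c => //; exact: (polycone_conic c).2. Qed.

Lemma hullsP k cs x : polyunion (hulls k cs) x <-> conek k.+1 (polyunion cs) x.
Proof.
elim: k x => [|k IH] x.
  split; first exact: conek1.
  move=> [s [s0 s1 scs ->]]; case: s s0 s1 scs => [//|p [|//]] _ _ /pos_in_cons[[p0 cp] _].
  by rewrite /lincomb big_seq1; exact: polyunionZ.
split=> [[c]|].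
  rewrite mem_cat => /orP[ck cx|/allpairsP[[a b]/= [acs bk ->]]].
    by apply: (@conekS _ _ k.+1) (leqnSn _) _ _ _; [exact: subset_refl|apply/IH; exists c].
  move=> /polysumP[y [z [ay bz ->]]]; rewrite -(add1n k.+1); apply: conekD.
    by apply: conek1; exists a.
  by apply/IH; exists b.
move=> [s [s0 sk scs ->]].
case: s s0 sk scs => [//|p t] _ tk /pos_in_cons[[p0 [c ccs cp]] tcs].
have [t0|t0] := eqVneq t [::].
  have /IH[d dk dp] : conek k.+1 (polyunion cs) (lincomb (p :: t)).
    by rewrite t0 /lincomb big_seq1; apply: conekZ => //; apply: conek1; exists c.
  by exists d => //; rewrite mem_cat dk.
have /IH[d dk dt] : conek k.+1 (polyunion cs) (lincomb t) by exists t.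
exists (polysum c d); first by rewrite mem_cat (allpairs_f polysum ccs dk) orbT.
apply/polysumP; exists (p.1 *: p.2), (lincomb t); split=> //.
  exact: (polycone_conic c).2.
by rewrite /lincomb big_cons.
Qed.

Lemma sub_hulls k cs : {subset cs <= hulls k cs}.
Proof. by elim: k => //= k IH c /IH; rewrite mem_cat => ->. Qed.

Lemma hulls_mono k cs cs' : {subset cs <= cs'} -> {subset hulls k cs <= hulls k cs'}.
Proof.
move=> sub; elim: k => //= k IH c; rewrite !mem_cat => /orP[/IH->//|].
by move=> /allpairsP[[a b]/= [/sub aP /IH bP ->]]; rewrite (allpairs_f polysum aP bP) orbT.
Qed.

Lemma hulls_inhabited k cs : proper_cones cs ->
  forall c, c \in hulls k cs -> exists x, polycone c x.
Proof.
move=> pcs; elim: k => [c /pcs[]//|k IH] c /=.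
rewrite mem_cat => /orP[/IH//|/allpairsP[[a b]/= [/pcs[_ [y ay]] /IH[z bz] ->]]].
by exists (y + z); apply/polysumP; exists y, z.
Qed.

(** Distributive law: an intersection of unions of half-spaces becomes a union of cones. *)
Fixpoint choices (ks : seq (seq V)) : seq (seq V) :=
  if ks is c :: ks' then [seq a :: d | a <- c, d <- choices ks'] else [:: [::]].

Lemma choicesP ks x : polyunion (choices ks) x <->
  forall c, c \in ks -> exists2 a, a \in c & 0 < dot a x.
Proof.
elim: ks => [|c ks IH] /=; first by split=> // _; exists [::].
split=> [[_ /allpairsP[[a d]/= [ac dks ->]] /polycone_cons[ax dx]] b|H].
  rewrite inE => /predU1P[->|bks]; first by exists a.
  by apply: IH.1 bks; exists d.
have [a ac ax] := H c (mem_head _ _).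
have [d dks dx] : polyunion (choices ks) x.
  by apply/IH => b bks; apply: H; rewrite inE bks orbT.
by exists (a :: d); [exact: (allpairs_f cons ac dks)|apply/polycone_cons].
Qed.

Lemma size_choices ks d : d \in choices ks -> size d = size ks.
Proof.
elim: ks d => [|c ks IH] d /=; first by rewrite inE => /eqP ->.
by move=> /allpairsP[[a e]/= [_ /IH <- ->]].
Qed.

(* Complement of minus the closure of the set of sums of at most [m.+1] points:
   the points that can be adjoined without creating a balanced set. *)
Definition free (cs : seq (seq V)) : set V := polyunion (choices (hulls m cs)).

Lemma freeP cs x : free cs x <->
  forall c, c \in hulls m cs -> exists2 a, a \in c & 0 < dot a x.
Proof. exact: choicesP. Qed.

(** The cone holding [x] is itself among the [hulls], and its forms are negative at [- x]. *)
Lemma free_opp cs x : polyunion cs x -> ~ free cs (- x).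
Proof.
move=> [c ccs cx] /freeP /(_ _ (sub_hulls m ccs))[a ac].
by rewrite dotNr oppr_gt0 ltNge ltW// cx.
Qed.

Lemma free_mono cs cs' : {subset cs <= cs'} -> free cs' `<=` free cs.
Proof. by move=> sub x /freeP fx; apply/freeP => c /(hulls_mono sub)/fx. Qed.

(** All forms of some cone are non-positive at [x], so adding to [- x] a positive multiple of an
    inner point [q] makes them positive. *)
Lemma not_free cs x : proper_cones cs -> ~ free cs x ->
  exists q, forall e : R, 0 < e -> conek m.+1 (polyunion cs) (e *: q - x).
Proof.
move=> pcs /freeP /existsNP[c /not_implyP[ck nx]].
have [q cq] := hulls_inhabited pcs ck.
exists q => e e0; apply/hullsP; exists c => // a ac.
rewrite dotDr dotNr dotZr ltr_pwDl ?mulr_gt0 ?cq// oppr_ge0 leNgt.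
by apply/negP => ax; apply: nx; exists a.
Qed.

(** The filter drops empty pieces, so that the cones remain proper. *)
Definition extend cs (X : seq V) : seq (seq V) :=
  cs ++ [seq c <- [seq X ++ d | d <- choices (hulls m cs)] | `[< exists x, polycone c x >]].

Lemma extendP cs X x : polyunion (extend cs X) x <->
  polyunion cs x \/ polycone X x /\ free cs x.
Proof.
split=> [[c]|[[c ccs cx]|[Xx [d dk dx]]]].
- rewrite mem_cat => /orP[ccs cx|]; first by left; exists c.
  rewrite mem_filter => /andP[_ /mapP[d dk ->]] /polycone_cat[Xx dx].
  by right; split=> //; exists d.
- by exists c => //; rewrite mem_cat ccs.
- have Xdx : polycone (X ++ d) x by apply/polycone_cat.
  exists (X ++ d) => //; rewrite mem_cat mem_filter; apply/orP; right.
  by apply/andP; split; [apply/asboolP; exists x|exact: map_f].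
Qed.

Lemma extend_proper cs X : X != [::] -> proper_cones cs -> proper_cones (extend cs X).
Proof.
move=> X0 pcs c; rewrite mem_cat => /orP[/pcs//|].
rewrite mem_filter => /andP[/asboolP cx /mapP[d _ cE]]; split=> //.
by rewrite cE; case: X X0 {cE}.
Qed.

(* With at least two points in the convex cone [X], a balanced set of at most
   three points leaves at most one point [u] outside, and then [- u] is in [X]. *)
Lemma extend_unbalanced cs X : (m <= 1)%N -> X != [::] ->
  ~ conek m.+2 (polyunion cs) 0 ->
  (forall x, polyunion cs x -> ~ polycone X (- x)) ->
  ~ conek m.+2 (polyunion (extend cs X)) 0.
Proof.
move=> m1 X0 ncs ncsX [s [s0 sm sX ls]].
pose P (p : R * V) := `[< polyunion cs p.2 >].
pose s1 := [seq p <- s | P p]; pose s2 := [seq p <- s | ~~ P p].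
have l12 : lincomb s1 + lincomb s2 = 0.
  by rewrite [RHS]ls /s1 /s2 /lincomb !big_filter [RHS](bigID P).
have sz12 : (size s1 + size s2 <= m.+2)%N.
  by rewrite !size_filter count_predC.
have s1P : pos_in (polyunion cs) s1.
  by move=> p; rewrite mem_filter => /andP[/asboolP csp /sX[]].
have s2P p : p \in s2 -> [/\ 0 < p.1, polycone X p.2 & free cs p.2].
  rewrite mem_filter => /andP[/asboolP csp /sX[p0 /extendP[//|[]]]].
  by split.
have X2 : s2 != [::] -> polycone X (lincomb s2).
  move=> s20; apply: conic_lincomb => //; first exact: polycone_conic.
  by move=> p /s2P[].
(* Points of [X] alone cannot balance, since this cone misses the origin. *)
have s12 : s2 != [::] -> s1 != [::].
  move=> /X2/(polycone_neq0 X0) l20; apply: contra_neq l20 => s10.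
  by have := l12; rewrite s10 lincomb0 add0r.
(* By the number of new points: none contradicts [ncs], one contradicts its being free, two or more
   leave a single old point. *)
case E2 : s2 => [|p [|q t]].
- apply: ncs; exists s1; split=> //; last 2 first.
  + by move: sz12; rewrite E2 addn0.
  + by have := l12; rewrite E2 lincomb0 addr0.
  apply: contra_neq s0 => s10.
  have := count_predC P s; rewrite -!size_filter -/s1 -/s2 s10 E2.
  by move/esym/size0nil.
- have [p0 Xp /freeP fp] : [/\ 0 < p.1, polycone X p.2 & free cs p.2].
    by apply: s2P; rewrite E2 mem_head.
  have : conek m.+1 (polyunion cs) (- p.2).
    have -> : - p.2 = (p.1)^-1 *: lincomb s1.
      have /eqP := l12; rewrite E2 lincomb1 addr_eq0 => /eqP ->.
      by rewrite scalerN scalerA mulVf ?scale1r// gt_eqF.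
    apply: conekZ; first by rewrite invr_gt0.
    exists s1; split=> //; first by apply: s12; rewrite E2.
    by move: sz12; rewrite E2/= addn1.
  move=> /hullsP[c ck cp]; have [a ac ap] := fp _ ck.
  by have := cp _ ac; rewrite dotNr oppr_gt0 ltNge ltW.
- have s20 : s2 != [::] by rewrite E2.
  case E1 : s1 (s12 s20) => [//|u [|u' t']] _; last first.
    by move: sz12; rewrite E1 E2/= !addSn !addnS !ltnS; case: m m1 => [|[]].
  have [u0 csu] : 0 < u.1 /\ polyunion cs u.2 by apply: s1P; rewrite E1 mem_head.
  apply: (ncsX _ csu).
  have -> : - u.2 = (u.1)^-1 *: lincomb s2.
    have /eqP := l12; rewrite E1 lincomb1 addrC addr_eq0 => /eqP ->.
    by rewrite scalerN scalerA mulVf ?scale1r// gt_eqF.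
  by apply: (polycone_conic X).2; [rewrite invr_gt0|exact: X2].
Qed.

(** The cones of [Xs] are adjoined one by one. Free sets shrink as cones are added, so a point of
    [X] that is free at the end was free, and adjoined, when [X] was treated. *)
Lemma saturate_free cs Xs : (m <= 1)%N -> proper_cones cs ->
  ~ conek m.+2 (polyunion cs) 0 -> (forall X, X \in Xs -> X != [::]) ->
  (forall x, polyunion cs x \/ polyunion Xs x -> ~ polyunion Xs (- x)) ->
  exists cs', [/\ proper_cones cs', ~ conek m.+2 (polyunion cs') 0, {subset cs <= cs'} &
    free cs' `&` polyunion Xs `<=` polyunion cs'].
Proof.
move=> m1; elim: Xs cs => [|X Xs IH] cs pcs ncs Xs0 ncsX.
  by exists cs; split=> // x [_ []].
have XE x : polycone X x -> polyunion (X :: Xs) x by move=> ?; exists X; rewrite ?mem_head.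
have XsE x : polyunion Xs x -> polyunion (X :: Xs) x.
  by move=> [c cXs cx]; exists c; rewrite ?inE ?cXs ?orbT.
have X0 : X != [::] by apply: Xs0; exact: mem_head.
have [||||cs' [pcs' ncs' sub' fcs']] := IH (extend cs X).
- exact: extend_proper.
- by apply: extend_unbalanced => // x csx /XE; apply: ncsX; left.
- by move=> Y YXs; apply: Xs0; rewrite inE YXs orbT.
- move=> x [/extendP[csx|[Xx _]]|Xsx] /XsE; apply: ncsX; [by left|right|right].
    exact: XE.
  exact: XsE.
exists cs'; split=> // [c ccs|x [fx [Y]]]; first by apply: sub'; rewrite mem_cat ccs.
rewrite inE => /predU1P[->|YXs] Yx; last by apply: fcs'; split=> //; exists Y.
have [c cc cx] : polyunion (extend cs X) x.
  by apply/extendP; right; split=> //; apply: free_mono fx => c ccs; apply: sub'; rewrite mem_cat ccs.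
by exists c => //; exact: sub'.
Qed.

Lemma polycone_opp (d : seq V) x : polycone [seq - a | a <- d] x <-> polycone d (- x).
Proof.
split=> [dx a ad|dx _ /mapP[a ad ->]].
  by rewrite dotNr -dotNl; apply: dx; exact: map_f.
by rewrite dotNl -dotNr; exact: dx.
Qed.

Lemma free_hulls_neq0 cs X : cs != [::] -> X \in choices (hulls m cs) -> X != [::].
Proof.
case: cs => [//|c cs] _ /size_choices sX; rewrite -size_eq0 sX -lt0n.
by have := sub_hulls m (mem_head c cs); case: (hulls _ _).
Qed.

Lemma separate_free cs : (m <= 1)%N -> proper_cones cs -> cs != [::] ->
  ~ conek m.+2 (polyunion cs) 0 ->
  exists cs', [/\ proper_cones cs', ~ conek m.+2 (polyunion cs') 0, {subset cs <= cs'} &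
    forall x, free cs' x -> ~ free cs' (- x)].
Proof.
move=> m1 pcs cs0 ncs.
have [g g0] : exists g : V, g != 0.
  case: cs pcs cs0 {ncs} => // c cs pcs _; have [c0 [x cx]] := pcs _ (mem_head _ _).
  by exists x; exact: polycone_neq0 cx.
pose F := choices (hulls m cs).
(* The free points with free antipodes form a symmetric set; the form [g] keeps one half of it,
   which contains no antipodal pair. *)
pose Xs := [seq g :: (d ++ [seq - a | a <- d']) | d <- F, d' <- F].
have XsP x : polyunion Xs x <-> [/\ 0 < dot g x, free cs x & free cs (- x)].
  split=> [[_ /allpairsP[[d d']/= [dF d'F ->]]]|[gx [d dF dx] [d' d'F d'x]]].
    move=> /polycone_cons[gx /polycone_cat[dx /polycone_opp d'x]].
    by split=> //; [exists d|exists d'].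
  exists (g :: (d ++ [seq - a | a <- d'])).
    by apply/allpairsP; exists (d, d').
  by apply/polycone_cons; split=> //; apply/polycone_cat; split=> //; exact/polycone_opp.
have [||cs' [pcs' ncs' sub fcs']] := @saturate_free cs Xs m1 pcs ncs.
- by move=> X /allpairsP[[d d']/= [_ _ ->]].
- move=> x [csx|/XsP[gx _ _]] /XsP[]; last by rewrite dotNr oppr_gt0 ltNge ltW.
  by move=> _ /(free_opp csx).
exists cs'; split=> //.
have pos x : 0 < dot g x -> free cs' x -> ~ free cs' (- x).
  move=> gx fx fNx; apply: (free_opp (x := x) _ fNx); apply: fcs'; split=> //.
  by apply/XsP; split=> //; exact: (free_mono sub).
move=> x fx fNx; have [gx|gx|gx] := ltgtP (dot g x) 0.
- by apply: (pos (- x)); rewrite ?opprK// dotNr oppr_gt0.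
- exact: (pos x).
(* On the hyperplane orthogonal to [g], openness of the cones around [x] and [- x] allows a small
   move of [x] along [g] into the half-space already treated. *)
- case: fx fNx => d dF dx [d' d'F d'x].
  have [e e0 eP] := polycone_perturb g dx; have [e' e'0 e'P] := polycone_perturb g d'x.
  pose h := Num.min e e' / 2.
  have h0 : 0 < h by rewrite divr_gt0// lt_min e0.
  have hlt : h < Num.min e e' by rewrite ltr_pdivrMr// ltr_pMr ?ltr1n// lt_min e0.
  move: hlt; rewrite lt_min => /andP[he he'].
  apply: (pos (x + h *: g)).
  + by rewrite dotDr gx add0r dotZr mulr_gt0// dot_gt0.
  + by exists d => //; apply: eP; rewrite gtr0_norm.
  + by exists d' => //; rewrite opprD -scaleNr; apply: e'P; rewrite normrN gtr0_norm.
Qed.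

(** After separation the free points contain no antipodal pair, so all their cones may be
    adjoined. *)
Lemma fill_free cs : (m <= 1)%N -> proper_cones cs -> cs != [::] ->
  ~ conek m.+2 (polyunion cs) 0 ->
  exists cs', [/\ proper_cones cs', ~ conek m.+2 (polyunion cs') 0, {subset cs <= cs'} &
    free cs' `<=` polyunion cs'].
Proof.
move=> m1 pcs cs0 /(separate_free m1 pcs cs0)[cs1 [pcs1 ncs1 sub1 sep]].
have cs10 : cs1 != [::].
  by case: cs sub1 cs0 {pcs} => // c cs /(_ _ (mem_head _ _)); case: cs1 {pcs1 ncs1 sep}.
have [||cs2 [pcs2 ncs2 sub2 fcs2]] := @saturate_free cs1 (choices (hulls m cs1)) m1 pcs1 ncs1.
- by move=> X; exact: free_hulls_neq0.
- by move=> x [/free_opp//|/sep].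
exists cs2; split=> // [c /sub1/sub2//|x fx].
by apply: fcs2; split=> //; exact: (free_mono sub2).
Qed.

End Free.

(** * Maxtame sets from unions of cones *)

Section Maxtame.
Variables (R : realType) (n : nat).
Local Notation V := 'rV[R]_n.
Local Notation S := (@sphere R n).

Lemma open_polyunion (cs : seq (seq V)) : open (polyunion cs).
Proof.
rewrite (_ : polyunion cs = \bigcup_(c in [set` cs]) polycone c); last first.
  by apply/seteqP; split=> x [c ccs cx]; exists c.
apply: bigcup_open => c _; elim: c => [|a c IH].
  by rewrite (_ : polycone [::] = setT); [exact: openT|apply/seteqP; split].
rewrite (_ : polycone (a :: c) = (fun x => dot x a) @^-1` [set z | 0 < z] `&` polycone c).
  apply: openI => //; apply: open_comp; last exact: open_gt.
  by move=> x _; exact: dot_continuous.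
by apply/seteqP; split=> x; rewrite /= dotC => /polycone_cons.
Qed.

(** Norms are absorbed into the coefficients. *)
Lemma conek_sphere k (K : set V) x : (forall y, K y -> y != 0) ->
  (forall (a : R) y, 0 < a -> K y -> K (a *: y)) ->
  conek k K x -> conek k (K `&` S) x.
Proof.
move=> K0 KZ [s [s0 sk sK ->]].
exists [seq (p.1 * Num.sqrt (dot p.2 p.2), normalize p.2) | p <- s]; split.
- by case: s s0 {sk sK}.
- by rewrite size_map.
- move=> _ /mapP[p /sK[p0 Kp] ->]; have p20 := K0 _ Kp.
  split=> /=; first by rewrite mulr_gt0// sqrtr_gt0 dot_gt0.
  by split; [apply: KZ => //; exact: sqrt_dot_gt0|exact: normalize_sphere].
- rewrite /lincomb big_map big_seq [RHS]big_seq; apply: eq_bigr => p /sK[_ /K0 p20] /=.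
  by rewrite /normalize scalerA mulfK// gt_eqF// sqrtr_gt0 dot_gt0.
Qed.

(** If a larger open tame set had a point [z] that is not free, a small displacement of [z] inside
    that set would be balanced by at most [m.+1] points of [W], hence [n] points in all. *)
Lemma maxtame_polyunion m (cs : seq (seq V)) : n = m.+2 -> proper_cones cs ->
  ~ conek n (polyunion cs) 0 -> free m cs `<=` polyunion cs ->
  maxtame (polyunion cs `&` S).
Proof.
move=> nm pcs ncs fcs; set W := polyunion cs `&` S.
have cs0 x : polyunion cs x -> x != 0.
  by move=> [c /pcs[c0 _]]; exact: polycone_neq0.
have tW : tame n W.
  apply: conek_tame => [x []//|Wn]; apply: ncs.
  by apply: conekS Wn => // x [].
have maxW Y : open_in S Y -> tame n Y -> W `<=` Y -> Y = W.
  move=> oY tY WY; apply/seteqP; split=> // z Yz; have Sz : S z by case: tY => + _; apply.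
  split=> //; apply: fcs; apply: contrapT => /(not_free pcs)[q qP].
  have [e e0 eY] := open_in_near oY Yz.
  (* This keeps [d *: q] shorter than [e], so that the displaced point is still in [Y] once
     normalized. *)
  pose d := e / 2 / (1 + `|q|).
  have q1 : 0 < 1 + `|q| by rewrite ltr_pwDl.
  have d0 : 0 < d by rewrite !divr_gt0.
  have [|y0 Yy] := eY (z - d *: q).
    rewrite addrAC subrr sub0r normrN normrZ gtr0_norm//.
    apply: (@le_lt_trans _ _ (e / 2)); last by rewrite ltr_pdivrMr// ltr_pMr// ltr1n.
    by rewrite /d mulrAC ler_pdivrMr// ler_wpM2l ?divr_ge0 ?ltW// ltrDr.
  apply: (tame_conek tY); apply: (@conekS _ _ m.+2 n Y Y) => //; first by rewrite -nm.
  rewrite -(subrr (normalize (z - d *: q))) -[m.+2]add1n; apply: conekD; first exact: conek1.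
  apply: (@conekS _ _ m.+1 m.+1 W Y) => //; apply: conek_sphere => //; first exact: polyunionZ.
  rewrite /normalize -scalerN opprB; apply: conekZ; first exact: sqrt_dot_gt0.
  exact: qP.
split=> //; split=> //; first by exists (polyunion cs) => //; exact: open_polyunion.
  apply: (@finite_components _ _ _ cs (fun c => S `&` polycone c)).
    move=> c /pcs[c0 _]; apply: connected_conic; first exact: polycone_conic.
    by move=> /(polycone_neq0 c0); rewrite eqxx.
  by move=> x; split=> [[[c ccs cx] Sx]|[c ccs [Sx cx]]]; [exists c|split=> //; exists c].
by move=> Y oY tY _ WY; exact: maxW.
Qed.

Lemma maxtame_above (U : set V) : (1 < n <= 3)%N -> open_in S U -> tame n U ->
  finite_set (components U) -> exists2 W : set V, maxtame W & U `<=` W.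
Proof.
move=> /andP[n1 n3] oU tU fU; have US : U `<=` S by case: tU.
have n0 : (0 < n)%N by exact: ltnW.
have [cs [pcs ncs Ucs cs0]] : exists cs, [/\ proper_cones cs, ~ conek n (polyunion cs) 0,
    U `<=` polyunion cs & cs != [::]].
  have [cs [pcs ncs Ucs]] := polyhedral_above n0 oU tU fU.
  (* No cones at all means that [U] is empty; an open half-space then serves as a start. *)
  have [E|cs0] := eqVneq cs [::]; last by exists cs.
  pose g : V := const_mx 1.
  have g0 : 0 < dot g g.
    rewrite dot_gt0; apply/eqP => /rowP/(_ (Ordinal n0))/eqP.
    by rewrite !mxE oner_eq0.
  exists [:: [:: g]]; split=> //.
  - move=> c; rewrite inE => /eqP ->; split=> //; exists g => a.
    by rewrite inE => /eqP ->.
  - move=> [s [s0 _ sg ls]]; suff : 0 < dot (lincomb s) g by rewrite -ls dot0l ltxx.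
    apply: dot_lincomb_gt0 s0 sg _ => x [c]; rewrite inE => /eqP -> /(_ _ (mem_head _ _)).
    by rewrite dotC.
  - by move=> x /Ucs[c]; rewrite E.
have nm : n = n.-2.+2 by case: n n1 => [|[]].
have m1 : (n.-2 <= 1)%N by case: n n3 => [|[|[|[]]]].
have [|cs' [pcs' ncs' sub fcs']] := @fill_free R n n.-2 cs m1 pcs cs0.
  by rewrite -nm.
rewrite -nm in ncs'.
exists (polyunion cs' `&` S); first exact: maxtame_polyunion nm _ _ _.
by move=> x Ux; split; [have [c /sub ccs cx] := Ucs _ Ux; exists c|exact: US].
Qed.

End Maxtame.

(** * The zero-dimensional sphere and the conclusion *)

Lemma maxtame_sphere1 (R : realType) : maxtame (@sphere R 1).
Proof.
(* A single non-zero vector is never balanced. *)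
have tS : tame 1 (@sphere R 1).
  apply: conek_tame => // -[s [s0 s1 sS]].
  case: s s0 s1 sS => [//|p [|//]] _ _ /pos_in_cons[[p0 Sp] _].
  rewrite /lincomb big_seq1 => /esym/eqP; rewrite scaler_eq0 gt_eqF//=.
  by rewrite (negbTE (sphere_neq0 Sp)).
have maxS V : tame 1 V -> @sphere R 1 `<=` V -> V = @sphere R 1.
  by move=> [VS _] SV; apply/seteqP; split.
split; last by move=> V _; exact: maxS.
split=> //; last by move=> V _ tV _; exact: maxS.
  by exists setT; [exact: openT|rewrite setTI].
apply: finite_image.
apply: (sub_finite_set (B := [set` [:: const_mx 1; const_mx (-1)]])); last exact: finite_seq.
move=> x; rewrite /sphere/= /dot big_ord1 -expr2 => /eqP; rewrite sqrf_eq1 !inE.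
by case/orP => /eqP x0; apply/orP; [left|right]; apply/eqP/rowP => i; rewrite !mxE ord1.
Qed.

Theorem theoremB (R : realType) (n : nat) (hn : (1 <= n)%N)
    (U : set 'rV[R]_n) (hU : tame n U)
    (hcases : closed_in (@sphere R n) U \/
              (open_in (@sphere R n) U /\ finite_set (components U))) :
  (exists2 W : set 'rV[R]_n, weakly_maxtame W & U `<=` W) /\
  ((n <= 3)%N -> exists2 W : set 'rV[R]_n, maxtame W & U `<=` W).
Proof.
have [W [oW tW fW UW]] : exists W : set 'rV[R]_n,
    [/\ open_in (@sphere R n) W, tame n W, finite_set (components W) & U `<=` W].
  case: hcases => [clU|[oU fU]]; first exact: closed_enlarge.
  by exists U; split.
split=> [|n3].
  have [Z wZ WZ] := weakly_maxtame_above oW tW fW.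
  by exists Z => //; exact: subset_trans WZ.
(* The construction with cones takes [n = m.+2]; for [n = 1] the whole sphere serves. *)
have [n1|n1] := ltnP 1 n.
  have [|Z mZ WZ] := maxtame_above _ oW tW fW; first by rewrite n1 n3.
  by exists Z => //; exact: subset_trans WZ.
have nE : n = 1%N by apply/eqP; rewrite eqn_leq n1 hn.
subst n; exists (@sphere R 1); first exact: maxtame_sphere1.
by case: hU.
Qed.
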